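(* Let $\gamma\ge 0$. There are constants $c_1,c_2>0$, depending only on $\gamma$, where moreover $c_1\le c\,(1+\gamma)^{-1/2}$ for a constant $c$ not depending on $\gamma$, such that for any $t,x,A>0$ and any integers $1\le k\le m$, $$\mathbb{P}\Big( \mathcal{L}_m^{(\mathcal{H}_{\gamma}^{A})} (\Lambda_{t,x}) \ge k \Big) \le \Big( \frac{c_1 A t^{\gamma} m }{x k^{1+\gamma}} \Big)^k ,$$ $$\mathbb{P}\Big( \mathcal{L}_m^{(\mathcal{H}_{\gamma}^{A})} (\Lambda_{t,x}) \le k \Big) \le \exp\bigg\{ c_2 k \Big( 1- c_2 \Big( \frac{At^{\gamma}}{ x k^{\gamma} } \wedge 1 \Big) \frac{m}{k} \Big) \bigg\} .$$ As a consequence, there is some $C>0$ such that for any fixed $t,x,\gamma,A$, $\mathbb{P}$-a.s. there is some $m_0$ such that $$\frac{1}{C}\le \frac{\mathcal{L}_m^{(\mathcal{H}_{\gamma}^{A})} (\Lambda_{t,x}) }{ (At^{\gamma}/x )^{1/(1+\gamma)}\, m^{1/(1+\gamma)} } \le C \quad \text{ for all } m\ge m_0 .$$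
   Context: For $t,x>0$ let $\Lambda_{t,x}=[0,t]\times[-x,x]$. Let $Z_1,Z_2,\dots$ be i.i.d. random points uniform in $\Lambda_{t,x}$, with law $\mathbb{P}$, and set $\Upsilon_m=\{Z_1,\dots,Z_m\}$. The first coordinate of a point is viewed as time. A finite set $\Delta=\{(t_i,x_i)\}_{1\le i\le k}\subset\mathbb{R}_+\times\mathbb{R}$ is called directed if its points can be labelled so that $0<t_1<\cdots<t_k$. For such a set (points ordered by increasing $t_i$, with the convention $(t_0,x_0)=(0,0)$) and $\gamma\ge 0$, define the local $\gamma$-Hölder norm $$\mathrm{H}_{\gamma}(\Delta)=\sup_{1\le i\le k}\frac{|x_i-x_{i-1}|}{|t_i-t_{i-1}|^{\gamma}}$$ (only consecutive points are compared). For $A>0$ let $\mathcal{H}_{\gamma}^{A}=\{\Delta\subset\mathbb{R}_+\times\mathbb{R} : \Delta \text{ directed},\ \mathrm{H}_{\gamma}(\Delta)\le A\}$ (the empty set is included). Define $$\mathcal{L}_m^{(\mathcal{H}_{\gamma}^{A})}(\Lambda_{t,x})=\sup\{|\Delta| : \Delta\subset\Upsilon_m,\ \Delta\in\mathcal{H}_{\gamma}^{A}\}.$$ Notation: $u\wedge v=\min(u,v)$.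
   Formalization: For γ=0 the almost-sure lower bound 1/C is replaced by (1/C)(1∧x/A), since for γ=0 and A≥2x one has L_m=m a.s., so the ratio is x/A, arbitrarily small, and no universal C works; all else is as stated. *)

(* Defs.v *)
From HB Require Import structures.
From mathcomp Require Export all_boot all_order all_algebra finmap.
From mathcomp Require Export all_classical all_reals all_analysis.
Export Order.TTheory GRing.Theory Num.Theory.
Export numFieldNormedType.Exports.

Set Implicit Arguments.
Unset Strict Implicit.
Unset Printing Implicit Defensive.

Local Open Scope classical_set_scope.
Local Open Scope ring_scope.
Local Open Scope fset_scope.

(* Points of the plane are pairs (time, space). *)

Section HolderSets.
Variable R : realType.
Implicit Types (D Y : {fset (R * R)}) (gamma A : R).

(* The path starts at the origin, hence also requires 0 < t_1. *)
Definition directed D : Prop :=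
  exists s : seq (R * R),
    perm_eq s D /\ path (fun p q : R * R => p.1 < q.1) (0, 0) s.

(* Only meaningful on directed sets, where the times are pairwise distinct, so
   that the sorted list is the labelling of the definition of [directed]. *)
Definition time_order D : seq (R * R) :=
  sort (fun p q : R * R => p.1 <= q.1) D.

(* [chain_point D i] is (t_i, x_i) for 0 <= i <= #|` D|, with (t_0, x_0) the
   origin. *)
Definition chain_point D (i : nat) : R * R :=
  nth (0, 0) ((0, 0) :: time_order D) i.

(* The quotients are nonnegative, so taking 0 as the neutral element of the
   maximum changes the supremum only when D is empty, where it gives 0. *)
Definition local_holder_norm gamma D : R :=
  \big[Num.max/0]_(i < #|` D|)
    (`|(chain_point D i.+1).2 - (chain_point D i).2|
     / `|(chain_point D i.+1).1 - (chain_point D i).1| `^ gamma).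

Definition holder_class gamma A : set {fset (R * R)} :=
  [set D | directed D /\ local_holder_norm gamma D <= A].

Definition max_card_in (H : set {fset (R * R)}) Y : nat :=
  \max_(D <- fpowerset Y | D \in H) #|` D|.

End HolderSets.

Section RandomPoints.
Context (d : measure_display) (T : measurableType d) (R : realType).
Variable P : probability T R.

Let plane := (measurableTypeR R * measurableTypeR R)%type.

Definition plane_measure : set plane -> \bar R :=
  (@lebesgue_measure R \x @lebesgue_measure R)%E.

Definition Lambda (t x : R) : set plane := `[0, t] `*` `[- x, x].

Definition uniform_on (L : set plane) (X : {RV P >-> plane}) : Prop :=
  forall B : set plane, measurable B ->
    P (X @^-1` B) = ((fine (plane_measure L))^-1%:E * plane_measure (B `&` L))%E.

Definition mutually_independent (Z : nat -> {RV P >-> plane}) : Prop :=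
  forall (J : {fset nat}) (B : nat -> set plane),
    (forall j, j \in J -> measurable (B j)) ->
    P (\bigcap_(j in [set` J]) (Z j @^-1` B j))
    = (\prod_(j <- J) P (Z j @^-1` B j))%E.

Definition iid_uniform (L : set plane) (Z : nat -> {RV P >-> plane}) : Prop :=
  (forall i, uniform_on L (Z i)) /\ mutually_independent Z.

(* The sequence is numbered from 0: its first m points are Z 0, ..., Z m.-1. *)
Definition Upsilon (Z : nat -> {RV P >-> plane}) (m : nat) (w : T) :
    {fset (R * R)} :=
  [fset p in [seq (Z i w : R * R) | i <- iota 0 m]].

Definition holder_lpp (gamma A : R) (Z : nat -> {RV P >-> plane}) (m : nat)
    (w : T) : nat :=
  max_card_in (holder_class gamma A) (Upsilon Z m w).

End RandomPoints.

(* Main.v *)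
Require Import Defs.
From mathcomp Require Import measurable_realfun zify ring lra.

(** For the upper bound, the box is cut into cells and a Hoelder chain is followed
    from cell to cell; a union bound over the index sequences and over the cells
    leaves a sum over chains of cells in at most [N] time slots.  Giving a time
    increment of [i] slots the weight [z ^+ i], at the total cost [z^-1 ^+ N],
    decouples the steps: each contributes a truncated Gamma-type sum
    [\sum_i (i + 1) `^ gamma * z ^+ i].  With [z = n / (n + 1)], [N = k n^2] and
    [n] about [1 + gamma], Stirling's bound turns this into the factor
    [(1 + gamma) `^ (- 1/2) / k `^ (1 + gamma)].

    For the lower bound, the points that fall in a narrow strip around the time
    axis and in distinct, well separated time slots form a Hoelder chain, so that
    a short longest chain leaves half of [2 k] slots empty.

    The almost sure statement follows by Borel-Cantelli along the values of the
    longest chain, i.e. for sample sizes [m k] of order [k `^ (1 + gamma)], and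
    monotonicity in [m]. *)

Set Implicit Arguments.
Unset Strict Implicit.
Unset Printing Implicit Defensive.

Local Open Scope classical_set_scope.
Local Open Scope ring_scope.

(** * Hoelder chains as paths of a step relation *)

Section HolderChains.
Variable R : realType.
Implicit Types (gamma A : R) (p q : R * R) (l : seq (R * R)).

Definition earlier p q := p.1 < q.1.

Definition holder_step gamma A p q :=
  (p.1 < q.1) && (`|q.2 - p.2| <= A * (q.1 - p.1) `^ gamma).

Lemma earlier_trans : transitive earlier.
Proof. by move=> q p r; exact: lt_trans. Qed.

Lemma earlier_irr : irreflexive earlier.
Proof. by move=> p; rewrite /earlier ltxx. Qed.

Lemma holder_path_earlier gamma A p l :
  path (holder_step gamma A) p l -> path earlier p l.
Proof. by apply: sub_path => u v /andP[]. Qed.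

(** The sorting relation compares times only, so it is not antisymmetric on the plane. It is on the
    points of [l], where equal times force equal positions, and this makes the sorted list
    unique. *)
Lemma time_order_path (D : {fset (R * R)}) l :
  perm_eq l D -> path earlier (0, 0) l -> time_order D = l.
Proof.
move=> lD lpath.
have ls : sorted earlier l by exact: path_sorted lpath.
have lsle : sorted (fun p q : R * R => p.1 <= q.1) l.
  by apply: sub_sorted ls => u v; exact: ltW.
rewrite -[RHS](sorted_sort _ lsle); last by move=> ? ? ?; exact: le_trans.
symmetry; apply/perm_sort_inP => //.
- by move=> u v _ _; exact: le_total.
- by move=> u v w _ _ _; exact: le_trans.
move=> u v ul vl /andP[uv vu].
have e1 : u.1 = v.1 by apply/le_anti/andP.
have := ls; rewrite (sorted_pairwise earlier_trans) => /(pairwiseP (0, 0)) pw.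
have [iul ivl] : (index u l < size l)%N /\ (index v l < size l)%N.
  by rewrite !index_mem.
case: (ltngtP (index u l) (index v l)) => [lt|lt|].
- by have := pw _ _ iul ivl lt; rewrite !nth_index // /earlier e1 ltxx.
- by have := pw _ _ ivl iul lt; rewrite !nth_index // /earlier e1 ltxx.
- by move=> /(congr1 (nth (0, 0) l)); rewrite !nth_index.
Qed.

(** The bound on the norm splits into one condition per consecutive pair, whose denominator is
    positive on a directed set; [0 <= A] accounts for the neutral element of the maximum. From here
    on chains are handled as paths, which suit induction. *)
Lemma holder_classP gamma A (D : {fset (R * R)}) : 0 <= A ->
  holder_class gamma A D <->
  exists l, perm_eq l D /\ path (holder_step gamma A) (0, 0) l.
Proof.
move=> A0.
have key l : perm_eq l D -> path earlier (0, 0) l ->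
    (local_holder_norm gamma D <= A) = path (holder_step gamma A) (0, 0) l.
  move=> lD lp; rewrite /local_holder_norm /chain_point (time_order_path lD lp).
  have sl : size l = #|` D| := perm_size lD.
  have q i : (i < size l)%N ->
      (`|((nth (0, 0) ((0, 0) :: l) i.+1).2 - (nth (0, 0) ((0, 0) :: l) i).2)|
       / `|((nth (0, 0) ((0, 0) :: l) i.+1).1 - (nth (0, 0) ((0, 0) :: l) i).1)|
          `^ gamma <= A)
      = holder_step gamma A (nth (0, 0) ((0, 0) :: l) i) (nth (0, 0) l i).
    move=> il; have /(pathP (0, 0))/(_ i il) := lp.
    rewrite /earlier /holder_step /= => lt; rewrite lt /=.
    by rewrite [X in _ / X `^ _]gtr0_norm ?subr_gt0 // ler_pdivrMr // powR_gt0 // subr_gt0.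
  apply/idP/idP.
    move=> /bigmax_leP[_ h]; apply/(pathP (0, 0)) => i il.
    rewrite -q //.
    have iD : (i < #|` D|)%N by rewrite -sl.
    exact: (h (Ordinal iD)).
  move=> /(pathP (0, 0)) h; apply/bigmax_leP; split=> // i _.
  by rewrite q ?sl //; apply: h; rewrite sl.
split=> [[[l [lD lp]] h]|[l [lD lp]]].
  by exists l; split=> //; rewrite -(key l).
have lp' := holder_path_earlier lp.
by split; [exists l|rewrite (key l)].
Qed.

End HolderChains.

(** * Longest chains of the sample, through sequences of sample indices *)

Section ChainsInSample.
Context (d : measure_display) (T : measurableType d) (R : realType).
Variable P : probability T R.
Variable Z : nat -> {RV P >-> (measurableTypeR R * measurableTypeR R)%type}.
Variables (gamma A : R).
Hypothesis A0 : 0 <= A.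

Definition sample_path (s : seq nat) (w : T) : bool :=
  path (holder_step gamma A) (0, 0) [seq (Z i w : R * R) | i <- s].

Lemma sample_path_uniq s w : sample_path s w -> uniq s.
Proof.
move=> /holder_path_earlier/path_sorted sp.
apply: (@map_uniq _ _ (fun i => Z i w : R * R)).
by apply: sorted_uniq sp; [exact: earlier_trans|exact: earlier_irr].
Qed.

(** Times increase strictly along the path, so its points are distinct and form a set with as many
    elements as [s]. *)
Lemma sample_path_leq m s w : all (fun i => (i < m)%N) s ->
  sample_path s w -> (size s <= holder_lpp gamma A Z m w)%N.
Proof.
move=> sm sp; rewrite /holder_lpp /max_card_in.
set l := [seq (Z i w : R * R) | i <- s].
have lu : uniq l.
  apply: sorted_uniq; [exact: earlier_trans|exact: earlier_irr|].
  by apply: path_sorted; exact: holder_path_earlier sp.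
have lD : perm_eq l [fset p in l]%fset.
  apply: uniq_perm => //; first exact: fset_uniq.
  by move=> p; rewrite !inE.
have szl : size s = #|` [fset p in l]%fset|.
  by rewrite -(size_map (fun i => Z i w : R * R) s) (perm_size lD).
rewrite szl.
apply: (@leq_bigmax_seq _ _ _ (fun D : {fset R * R} => #|` D|)).
  rewrite fpowersetE; apply/fsubsetP => p; rewrite !inE => /mapP[i si ->].
  apply/mapP; exists i => //; rewrite mem_iota add0n.
  by move/allP: sm => /(_ i si).
by rewrite in_setE; apply/holder_classP => //; exists l.
Qed.

(** Only consecutive points are compared, starting at the origin, so an initial segment of a chain
    is a chain: a long chain can be cut to length exactly [k]. *)
Lemma leq_sample_path m k w : (k <= holder_lpp gamma A Z m w)%N ->
  exists s, [/\ size s = k, all (fun i => (i < m)%N) s & sample_path s w].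
Proof.
case: k => [_|k]; first by exists [::].
move=> km.
have [D DY [DH kD]] : exists2 D, D \in fpowerset (Upsilon Z m w) &
    D \in holder_class gamma A /\ (k < #|` D|)%N.
  apply: contrapT => h.
  suff : (holder_lpp gamma A Z m w <= k)%N by rewrite leqNgt km.
  apply/bigmax_leqP_seq => D DY DH; rewrite leqNgt; apply/negP => kD.
  by apply: h; exists D.
move: DH; rewrite in_setE => /(holder_classP _ _ A0)[l [lD lp]].
have lY p : p \in take k.+1 l -> exists2 i, (i < m)%N & p = Z i w.
  move=> /mem_take; rewrite (perm_mem lD) => pD.
  move: DY; rewrite fpowersetE => /fsubsetP/(_ _ pD).
  rewrite !inE => /mapP[i]; rewrite mem_iota add0n => /andP[_ im] ->.
  by exists i.
have kl : size (take k.+1 l) = k.+1.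
  by rewrite size_takel // (perm_size lD).
have lpk : path (holder_step gamma A) (0, 0) (take k.+1 l).
  by move: lp; rewrite -{1}(cat_take_drop k.+1 l) cat_path => /andP[].
have [s [sm sl]] : exists s, all (fun i => (i < m)%N) s /\
    [seq (Z i w : R * R) | i <- s] = take k.+1 l.
  elim: (take k.+1 l) lY => [|p l' ih] h; first by exists [::].
  have [i im pi] := h p (mem_head _ _).
  have [|s [sm sl]] := ih; first by move=> q ql; apply: h; rewrite inE ql orbT.
  by exists (i :: s); rewrite /= im sm sl pi.
exists s; split=> //.
  by rewrite -kl -sl size_map.
by rewrite /sample_path sl.
Qed.

Lemma holder_lpp_mono m n w : (m <= n)%N ->
  (holder_lpp gamma A Z m w <= holder_lpp gamma A Z n w)%N.
Proof.
move=> mn; have [s [<- sm sp]] := leq_sample_path (leqnn (holder_lpp gamma A Z m w)).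
by apply: sample_path_leq sp; apply: sub_all sm => i im; exact: leq_trans mn.
Qed.

(** A finite union over index tuples, used both for measurability and for the union bound in the
    upper tail. *)
Lemma holder_lpp_geE m k : [set w | (k <= holder_lpp gamma A Z m w)%N] =
  \bigcup_(s in [set s : k.-tuple 'I_m | true])
    [set w | sample_path [seq val i | i <- s] w].
Proof.
apply/seteqP; split=> w /=.
  move=> /leq_sample_path[s [sk sm sp]].
  have [s' ss] : exists s' : seq 'I_m, [seq val i | i <- s'] = s.
    elim: s sm {sk sp} => [_|i s ih /= /andP[im /ih[s' <-]]]; first by exists [::].
    by exists (Ordinal im :: s').
  have s'k : size s' == k by rewrite -(size_map val) ss sk.
  by exists (Tuple s'k) => //=; rewrite ss.
move=> [s _ /= sp].
rewrite -(size_tuple s) -(size_map val); apply: sample_path_leq => //.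
by apply/allP => _ /mapP[i _ ->]; exact: ltn_ord.
Qed.

(** * Measurability of the events *)

Lemma measurable_holder_step (X Y : T -> (measurableTypeR R * measurableTypeR R)%type) :
  measurable_fun setT X -> measurable_fun setT Y ->
  measurable [set w | holder_step gamma A (X w : R * R) (Y w : R * R)].
Proof.
move=> mX mY.
have mX1 : measurable_fun setT (fun w => (X w).1 : measurableTypeR R).
  exact: measurableT_comp mX.
have mX2 : measurable_fun setT (fun w => (X w).2 : measurableTypeR R).
  exact: measurableT_comp mX.
have mY1 : measurable_fun setT (fun w => (Y w).1 : measurableTypeR R).
  exact: measurableT_comp mY.
have mY2 : measurable_fun setT (fun w => (Y w).2 : measurableTypeR R).
  exact: measurableT_comp mY.
have m1 : measurable_fun setT (fun w => (X w).1 < (Y w).1 :> R).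
  exact: measurable_fun_ltr.
have m2 : measurable_fun setT (fun w =>
    `|(Y w).2 - (X w).2 : R| <= A * ((Y w).1 - (X w).1 : R) `^ gamma).
  apply: measurable_fun_ler.
    by apply: measurableT_comp => //; exact: measurable_funB.
  apply: measurable_funM => //.
  apply: (@measurableT_comp _ _ _ _ _ _ (fun u : measurableTypeR R => u `^ gamma : R)).
    exact: measurable_powR.
  exact: measurable_funB.
have := measurable_and m1 m2.
move=> /(_ measurableT [set true] I); rewrite setTI.
by congr (measurable _); apply/seteqP; split=> w.
Qed.

Lemma measurable_sample_path s : measurable [set w | sample_path s w].
Proof.
(* The starting point is any measurable map, because in the induction it becomes a sample point; the
   origin is the constant case. *)
have mpath (X : T -> (measurableTypeR R * measurableTypeR R)%type) :
    measurable_fun setT X ->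
    measurable [set w | path (holder_step gamma A) (X w : R * R)
                          [seq (Z i w : R * R) | i <- s]].
  elim: s X => [|i s ih] X mX /=.
    rewrite (_ : [set _ | _] = setT); first exact: measurableT.
    by apply/seteqP; split.
  rewrite (_ : [set _ | _] = [set w | holder_step gamma A (X w : R * R) (Z i w : R * R)]
     `&` [set w | path (holder_step gamma A) (Z i w) [seq (Z i w : R * R) | i <- s]]).
    apply: measurableI; first exact: measurable_holder_step.
    exact: (ih (Z i)).
  by apply/seteqP; split=> w /= => [/andP|[-> ->]].
apply: (mpath (fun=> (0, 0))); exact: measurable_cst.
Qed.

Lemma measurable_holder_lpp_ge m k :
  measurable [set w | (k <= holder_lpp gamma A Z m w)%N].
Proof.
rewrite holder_lpp_geE; apply: fin_bigcup_measurable => // s _.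
exact: measurable_sample_path.
Qed.

Lemma measurable_holder_lpp_le m k :
  measurable [set w | (holder_lpp gamma A Z m w <= k)%N].
Proof.
rewrite (_ : [set _ | _] = ~` [set w | (k.+1 <= holder_lpp gamma A Z m w)%N]).
  exact/measurableC/measurable_holder_lpp_ge.
apply/seteqP; split=> w /=; first by rewrite leqNgt => /negP.
by move=> /negP; rewrite -leqNgt.
Qed.

End ChainsInSample.

(** * Truncated geometric sums with polynomial weights, and Stirling's bound *)

Section WeightedSums.
Variable R : realType.
Implicit Types (z gamma : R).

(** Pascal's rule, as a truncated form of the series [\sum_d 'C(d + r, r) z^d = (1 - z)^-(r + 1)].
    The boundary term is subtracted, so an upper bound may drop it. *)
Lemma sum_bin_geo_rec z r M :
  (1 - z) * \sum_(d < M) 'C(d + r.+1, r.+1)%:R * z ^+ d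
  = \sum_(d < M) 'C(d + r, r)%:R * z ^+ d - 'C(M + r, r.+1)%:R * z ^+ M.
Proof.
elim: M => [|M ih]; first by rewrite !big_ord0 mulr0 add0n bin_small // mul0r subr0.
rewrite !big_ord_recr /= mulrDr ih addSn addnS binS natrD exprS.
ring.
Qed.

Lemma sum_bin_geo_le z r M : 0 <= z < 1 ->
  \sum_(d < M) 'C(d + r, r)%:R * z ^+ d <= (1 - z)^-1 ^+ r.+1.
Proof.
move=> /andP[z0 z1]; have z1' : 0 < 1 - z by rewrite subr_gt0.
elim: r => [|r ih].
  under eq_bigr do rewrite bin0 mul1r.
  rewrite expr1 -[leRHS]mul1r ler_pdivlMr // -[leLHS]opprK -mulrN opprB mulrC -subrX1 opprB.
  by rewrite gerBl exprn_ge0.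
rewrite exprS -ler_pdivrMl ?invr_gt0 // invrK sum_bin_geo_rec.
by apply: le_trans ih; rewrite gerBl mulr_ge0 // exprn_ge0.
Qed.

Lemma expn_leq_ffact d r : (d.+1 ^ r <= (d + r) ^_ r)%N.
Proof.
elim: r => [|r ih]; first by rewrite expn0 ffactn0.
by rewrite addnS ffactSS expnS leq_mul // ltnS leq_addr.
Qed.

(** Discrete counterpart of the Gamma integral of [u^r e^(- s u)], which is [r! / s^(r + 1)], with
    [1 - z] in the place of [s]. *)
Lemma sum_expn_geo_le z r M : 0 <= z < 1 ->
  \sum_(d < M) d.+1%:R ^+ r * z ^+ d <= r`!%:R * (1 - z)^-1 ^+ r.+1.
Proof.
move=> z01; apply: le_trans (ler_wpM2l (ler0n _ _) (sum_bin_geo_le r M z01)).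
rewrite mulr_sumr ler_sum // => d _; rewrite mulrA ler_wpM2r //.
  by rewrite exprn_ge0 //; case/andP: z01.
by rewrite -natrM -natrX ler_nat mulnC bin_ffact expn_leq_ffact.
Qed.

(** For [v < 1] this is [e^(2 v) <= (1 + v) / (1 - v)]. The difference of the two sides vanishes at
    0 and has the nonnegative derivative [v (e^v - e^(- v))]. *)
Lemma expR_sym_le (v : R) : 0 <= v -> (1 - v) * expR v <= (1 + v) * expR (- v).
Proof.
move=> v0.
pose f (u : R) : R := (1 + u) * expR (- u) - (1 - u) * expR u.
have df (u : R) : is_derive u 1 f (u * (expR u - expR (- u))).
  by rewrite /f; apply: is_derive_eq; rewrite /GRing.scale/=; ring.
have cf (u : R) : {for u, continuous f}.
  exact/differentiable_continuous/derivable1_diffP/ex_derive.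
have : f 0 <= f v.
  apply: (@ger0_derive1_ndecry _ f 0) => //.
  - by move=> u; rewrite in_itv/= andbT => u0; rewrite derive1E (@derive_val _ _ _ _ _ _ _ (df u)); apply: mulr_ge0; [exact: ltW|rewrite subr_ge0 ler_expR; lra].
  - by apply: continuous_subspaceT => u; exact: cf.
rewrite /f oppr0 expR0; lra.
Qed.

(** Stirling's upper bound by induction: passing from [N] to [N + 1] requires
    [(1 + 1/N)^(N + 1/2) >= e], which is proved in squared form to remove the roots. *)
Lemma fact_expR_le n : (0 < n)%N ->
  n`!%:R * expR n%:R <= expR 1 * Num.sqrt n%:R * n%:R ^+ n :> R.
Proof.
case: n => // n _; elim: n => [|n ih].
  by rewrite factS fact0 !mul1r sqrtr1 expr1 !mulr1.
have n0 : 0 < n.+1%:R :> R by [].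
have -> : expR n.+2%:R = expR n.+1%:R * expR 1 :> R by rewrite -expRD natr1.
rewrite factS natrM.
have -> : n.+2%:R * n.+1`!%:R * (expR n.+1%:R * expR 1)
  = (n.+2%:R * expR 1) * (n.+1`!%:R * expR n.+1%:R) :> R by ring.
apply: le_trans (ler_wpM2l _ ih) _; first by rewrite mulr_ge0 ?expR_ge0.
set e := expR 1; rewrite [n.+2%:R ^+ _]exprS.
have -> : n.+2%:R * e * (e * Num.sqrt n.+1%:R * n.+1%:R ^+ n.+1)
  = (e * n.+2%:R) * (e * Num.sqrt n.+1%:R * n.+1%:R ^+ n.+1) :> R by ring.
have -> : e * Num.sqrt n.+2%:R * (n.+2%:R * n.+2%:R ^+ n.+1)
  = (e * n.+2%:R) * (Num.sqrt n.+2%:R * n.+2%:R ^+ n.+1) :> R by ring.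
rewrite ler_wpM2l ?mulr_ge0 ?expR_ge0 //.
have sq (a b : R) : 0 <= a -> 0 <= b -> a ^+ 2 <= b ^+ 2 -> a <= b.
  by move=> a0 b0; rewrite ler_sqr ?nnegrE.
apply: sq; rewrite ?mulr_ge0 ?expR_ge0 ?sqrtr_ge0 ?exprn_ge0 //.
rewrite !exprMn !sqr_sqrtr // /e -expRM_natl -exprM -[n.+2%:R ^+ _ ^+ 2]exprM.
have {}ih : expR (2 / (2 * n.+1%:R + 1)) <= n.+2%:R / n.+1%:R :> R.
  (* With this [v] the quotient [(1 + v) / (1 - v)] is exactly [(n + 2) / (n + 1)]. *)
  pose v : R := (2 * n.+1%:R + 1)^-1.
  have d0 : 0 < 2 * n.+1%:R + 1 :> R by rewrite addr_gt0 ?mulr_gt0.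
  have v0 : 0 <= v by rewrite invr_ge0 ltW.
  have := expR_sym_le v0; rewrite expRN -/v.
  rewrite ler_pdivlMr ?expR_gt0 // -mulrA -expRD.
  have -> : v + v = 2 / (2 * n.+1%:R + 1) by rewrite /v; field; lra.
  have -> : 1 - v = n.+1%:R * (2 * v) by rewrite /v; field; lra.
  have -> : 1 + v = n.+2%:R * (2 * v).
    by rewrite /v -addn1 natrD; field; lra.
  rewrite -mulrA mulrCA -[leRHS]mulrC ler_pM2l ?mulr_gt0 ?invr_gt0 //.
  by rewrite ler_pdivlMr // mulrC.
have d0 : 0 < 2 * n.+1%:R + 1 :> R by rewrite addr_gt0 ?mulr_gt0.
have := @lerXn2r _ (n.+1 * 2).+1 _ _ _ _ ih.
rewrite !nnegrE expR_ge0 divr_ge0 // => /(_ isT isT).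
rewrite -expRM_natl expr_div_n.
have -> : (n.+1 * 2).+1%:R * (2 / (2 * n.+1%:R + 1)) = 2 * 1 :> R.
  by rewrite -addn1 natrD natrM; field; lra.
rewrite ler_pdivlMr ?exprn_gt0 // !exprS => h.
by rewrite -mulrA.
Qed.

Lemma expn_succ_le n : n.+1%:R ^+ n <= expR 1 * n%:R ^+ n :> R.
Proof.
case: n => [|n]; first by rewrite !expr0 mulr1 -expR0 ler_expR.
have n0 : 0 < n.+1%:R :> R by [].
rewrite -ler_pdivrMr ?exprn_gt0 // -expr_div_n.
have -> : expR 1 = expR (n.+1%:R^-1) ^+ n.+1 :> R.
  by rewrite -expRM_natl divff.
rewrite lerXn2r ?nnegrE ?divr_ge0 ?expR_ge0 //.
apply: le_trans (expR_ge1Dx _); rewrite -[n.+2]addn1 natrD mulrDl divff //.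
by rewrite mul1r.
Qed.

(** Replaces a real exponent by its two neighbouring integers, the lower one for [v <= 1] and the
    upper one for [v > 1]. *)
Lemma powR_le_addX (v : R) gamma : 0 < v -> 0 <= gamma ->
  v `^ gamma <= v ^+ Num.truncn gamma + v ^+ (Num.truncn gamma).+1.
Proof.
move=> v0 g0; have /andP[g1 g2] := truncn_itv g0.
have [v1|v1] := leP v 1.
  apply: le_trans (_ : v ^+ Num.truncn gamma <= _); last by rewrite lerDl exprn_ge0 ?ltW.
  by rewrite -powR_mulrn ?(ltW v0) // (@ger_powR _ v) ?v0.
apply: le_trans (_ : v ^+ (Num.truncn gamma).+1 <= _); last by rewrite lerDr exprn_ge0 ?ltW.
by rewrite -powR_mulrn ?(ltW v0) // (@ler_powR _ v) // ltW.
Qed.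

(** The factor [expR n%:R] is the share of one step in the cost of all time slots. The terms of the
    sum are largest for [d] about [gamma n], whence the scale [n^2]. Stirling's bound absorbs the
    exponential and leaves a factor of order [n^(-1/2)]. *)
Lemma weight_le gamma M (n := (Num.truncn gamma).+1) : 0 <= gamma ->
  expR n%:R * (\sum_(d < M) d.+1%:R `^ gamma * (n%:R / n.+1%:R) ^+ d)
    / n%:R `^ (2 * (1 + gamma)) <= 6 * expR 2 * (1 + gamma) `^ (- 2^-1).
Proof.
move=> g0; set r := Num.truncn gamma; have nE : n = r.+1 by [].
set N : R := n%:R; have N0 : 0 < N by [].
have N1 : 1 <= N by rewrite ler1n.
set z := N / n.+1%:R; have n10 : 0 < n.+1%:R :> R by [].
have z01 : 0 <= z < 1.
  by rewrite divr_ge0 //= ltr_pdivrMr // mul1r ltr_nat.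
have zE : (1 - z)^-1 = n.+1%:R.
  by rewrite /z -[n.+1%:R]natr1 -/N; field; rewrite -/N; apply/andP; split; lra.
pose w : R := (N ^+ 2) `^ gamma; have w0 : 0 < w by rewrite powR_gt0 ?exprn_gt0.
have NE : N `^ (2 * (1 + gamma)) = w * N ^+ 2.
  rewrite powRrM powR_mulrn ?(ltW N0) // powRD ?powRr1 ?exprn_ge0 ?(ltW N0) //; first by rewrite mulrC.
  by rewrite expf_neq0 ?implybT // gt_eqF.
rewrite NE.
pose s j : R := \sum_(d < M) d.+1%:R ^+ j * z ^+ d.
(* Dividing [d + 1] by [N ^+ 2] before passing to integer exponents keeps the two resulting terms of
   comparable size. *)
have sumle : \sum_(d < M) d.+1%:R `^ gamma * z ^+ d
    <= w * (s r / N ^+ (2 * r) + s n / N ^+ (2 * n)).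
  rewrite /s !mulr_suml -big_split /= mulr_sumr ler_sum // => d _.
  have z0 : 0 <= z ^+ d by rewrite exprn_ge0 //; case/andP: z01.
  rewrite -![_ * z ^+ d / _]mulrAC -mulrDl mulrA ler_wpM2r //.
  have -> : d.+1%:R = N ^+ 2 * (d.+1%:R / N ^+ 2) by field; lra.
  rewrite powRM ?exprn_ge0 ?divr_ge0 ?exprn_ge0 ?(ltW N0) // -/w ler_pM2l //.
  have -> : N ^+ 2 * (d.+1%:R / N ^+ 2) = d.+1%:R by field; lra.
  rewrite !exprM -!expr_div_n nE; apply: powR_le_addX => //.
  by rewrite divr_gt0 ?exprn_gt0.
have [sr sn] : s r <= r`!%:R * n.+1%:R ^+ n /\ s n <= n`!%:R * n.+1%:R ^+ n.+1.
  by rewrite /s -zE; split; exact: sum_expn_geo_le.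
have G := fact_expR_le (ltn0Sn r : (0 < n)%N); have E := expn_succ_le n.
rewrite -/N in G E.
pose e : R := expR 1; have e0 : 0 < e by rewrite expR_gt0.
have e2 : expR 2 = e ^+ 2 by rewrite -expRM_natl mulr1.
pose q := Num.sqrt N; have q0 : 0 < q by rewrite sqrtr_gt0.
have qq : q ^+ 2 = N by rewrite sqr_sqrtr // ltW.
have Nq : N^-1 * q = q^-1 by rewrite -qq; field; rewrite gt_eqF.
(* Stirling's bound cancels [expR N], and [(n + 1)^n <= e n^n] costs one more factor [e]. Both [b1]
   and [b2] follow from this estimate. *)
have GE : n`!%:R * expR N * n.+1%:R ^+ n <= e ^+ 2 * q * (N ^+ n) ^+ 2.
  have -> : e ^+ 2 * q * (N ^+ n) ^+ 2 = (e * q * N ^+ n) * (e * N ^+ n) by ring.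
  by apply: ler_pM => //; rewrite ?mulr_ge0 ?expR_ge0 ?exprn_ge0.
have Nn0 : 0 < N ^+ n by rewrite exprn_gt0.
have rn : N ^+ (2 * r) = (N ^+ n) ^+ 2 / N ^+ 2.
  by rewrite nE mulnC [N ^+ r.+1]exprS exprM; field; lra.
have fn : n`!%:R = N * r`!%:R :> R by rewrite nE factS natrM.
have b1 : expR N * (s r / N ^+ (2 * r)) / N ^+ 2 <= e ^+ 2 / q.
  have -> : expR N * (s r / N ^+ (2 * r)) / N ^+ 2 = expR N * s r / (N ^+ n) ^+ 2.
    by rewrite rn; field; rewrite !gt_eqF.
  rewrite ler_pdivrMr ?exprn_gt0 //.
  apply: le_trans (ler_wpM2l (expR_ge0 _) sr) _.
  have -> : e ^+ 2 / q * (N ^+ n) ^+ 2 = N^-1 * (e ^+ 2 * q * (N ^+ n) ^+ 2).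
    rewrite (_ : N^-1 * _ = e ^+ 2 * (N^-1 * q) * (N ^+ n) ^+ 2); last by ring.
    by rewrite Nq.
  rewrite ler_pdivlMl //; apply: le_trans GE; rewrite fn le_eqVlt; apply/orP; left.
  by apply/eqP; ring.
have b2 : expR N * (s n / N ^+ (2 * n)) / N ^+ 2 <= 2 * e ^+ 2 / q.
  have -> : expR N * (s n / N ^+ (2 * n)) / N ^+ 2
      = expR N * s n / ((N ^+ n) ^+ 2 * N ^+ 2).
    by rewrite mulnC exprM; field; rewrite !gt_eqF.
  rewrite ler_pdivrMr ?mulr_gt0 ?exprn_gt0 //.
  apply: le_trans (ler_wpM2l (expR_ge0 _) sn) _.
  have -> : 2 * e ^+ 2 / q * ((N ^+ n) ^+ 2 * N ^+ 2)
      = (2 * N) * (e ^+ 2 * q * (N ^+ n) ^+ 2).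
    by rewrite -Nq; field; rewrite !gt_eqF.
  have -> : expR N * (n`!%:R * n.+1%:R ^+ n.+1)
      = n.+1%:R * (n`!%:R * expR N * n.+1%:R ^+ n) by rewrite exprS; ring.
  by apply: ler_pM => //; rewrite ?mulr_ge0 ?expR_ge0 ?exprn_ge0 // -natr1 -/N; lra.
have qg : q^-1 <= 2 * (1 + gamma) `^ (- 2^-1).
  have g1 : 0 < 1 + gamma by lra.
  rewrite powRN powR12_sqrt ?(ltW g1) //.
  rewrite ler_pdivlMr ?sqrtr_gt0 // ler_pdivrMl //.
  have -> : 2 = Num.sqrt 4 :> R.
    by rewrite -[4]/(2 * 2)%:R natrM -expr2 sqrtr_sqr ger0_norm.
  rewrite mulrC -sqrtrM // ler_wsqrtr //.
  have /andP[_ gn] := truncn_itv g0; rewrite -/r -nE -/N in gn; lra.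
apply: le_trans (_ : expR N * (w * (s r / N ^+ (2 * r) + s n / N ^+ (2 * n)))
   / (w * N ^+ 2) <= _).
  rewrite ler_pM2r ?invr_gt0 ?mulr_gt0 ?exprn_gt0 //.
  by rewrite ler_pM2l ?expR_gt0.
have -> : expR N * (w * (s r / N ^+ (2 * r) + s n / N ^+ (2 * n))) / (w * N ^+ 2)
  = expR N * (s r / N ^+ (2 * r)) / N ^+ 2 + expR N * (s n / N ^+ (2 * n)) / N ^+ 2.
  set a := s r / _; set b := s n / _; field.
  by rewrite !gt_eqF.
apply: le_trans (lerD b1 b2) _.
have -> : e ^+ 2 / q + 2 * e ^+ 2 / q = 3 * e ^+ 2 * q^-1 by ring.
have -> : 6 * expR 2 * (1 + gamma) `^ (- 2^-1)
  = 3 * e ^+ 2 * (2 * (1 + gamma) `^ (- 2^-1)) by rewrite e2; ring.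
by rewrite ler_pM2l ?mulr_gt0 ?exprn_gt0.
Qed.

Lemma count_near_le (M l : nat) (B : R) : 0 <= B ->
  \sum_(l' < M | `|l'%:R - l%:R| <= B) 1 <= 2 * B + 1 :> R.
Proof.
move=> B0; have /andP[b1 b2] := truncn_itv B0; set b := Num.truncn B in b1 b2.
rewrite sumr_const.
apply: le_trans (_ : (2 * b + 1)%:R <= _); last first.
  by rewrite natrD natrM lerD2r ler_pM2l.
(* If [l < b], the window starts at 0 and still contains all naturals up to [l + b]. *)
rewrite ler_nat cardE -(size_map val) -(size_iota (l - b) (2 * b + 1)).
apply: uniq_leq_size; first by rewrite map_inj_uniq ?enum_uniq //; exact: val_inj.
move=> j /mapP[i]; rewrite mem_enum unfold_in => iB ->; rewrite mem_iota.
have : (`|i%:Z - l%:Z| < b.+1%:Z)%R.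
  rewrite -(ltr_int R) intr_norm rmorphB /=.
  exact: le_lt_trans iB b2.
by rewrite /=; lia.
Qed.

End WeightedSums.

(** * Union bounds, independence and chains of cells *)

Lemma measure_fin_cover (d : measure_display) (T : measurableType d) (R : realType)
    (mu : {measure set T -> \bar R}) (I : finType) (Q : pred I) (E : set T)
    (F : I -> set T) :
  measurable E -> (forall i, Q i -> measurable (F i)) ->
  E `<=` \bigcup_(i in [set i | Q i]) F i ->
  (mu E <= \sum_(i | Q i) mu (F i))%E.
Proof.
move=> mE mF EF; apply: le_trans (content_sub_fsum mu finite_finset mF mE EF) _.
rewrite (fsbigE (enum Q)) ?enum_uniq //.
- rewrite big_enum_cond /= le_eqVlt; apply/orP; left; apply/eqP.
  by apply: eq_bigl => i; rewrite mem_setE /= ?unfold_in ?andbb.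
- by move=> i /=; rewrite mem_enum.
- by move=> i /= Qi; rewrite mem_enum unfold_in Qi.
Qed.

Section Cylinders.
Context (d : measure_display) (T : measurableType d) (R : realType).
Variable P : probability T R.
Variable Z : nat -> {RV P >-> (measurableTypeR R * measurableTypeR R)%type}.
Hypothesis indep : mutually_independent Z.

(** Events of the form to which the independence hypothesis applies directly; a constraint on a
    fresh index contributes a factor. *)
Definition cylinder (J : {fset nat}) (E : set T) : Prop :=
  exists B : nat -> set (measurableTypeR R * measurableTypeR R)%type,
    (forall j, j \in J -> measurable (B j)) /\
    E = \bigcap_(j in [set` J]) (Z j @^-1` B j).

Lemma measurable_preimage_point i (B : set (measurableTypeR R * measurableTypeR R)%type) :
  measurable B -> measurable (Z i @^-1` B).
Proof.
by move=> mB; rewrite -[X in measurable X]setTI; exact: (measurable_funPT (Z i)).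
Qed.

Lemma measurable_cylinder J E : cylinder J E -> measurable E.
Proof.
move=> [B [mB ->]]; apply: fin_bigcap_measurable => //.
by move=> j jJ; apply: measurable_preimage_point; exact: mB.
Qed.

Lemma cylinder_setT : cylinder fset0 setT.
Proof.
exists (fun=> setT); split=> //.
by apply/seteqP; split.
Qed.

Lemma cylinderI J E i (C : set (measurableTypeR R * measurableTypeR R)%type) :
  cylinder J E -> i \notin J -> measurable C ->
  cylinder (i |` J)%fset (E `&` Z i @^-1` C) /\
  P (E `&` Z i @^-1` C) = (P E * P (Z i @^-1` C))%E.
Proof.
move=> [B [mB EB]] iJ mC.
pose B' j := if j == i then C else B j.
have B'J j : j \in J -> B' j = B j.
  by move=> jJ; rewrite /B'; case: eqP => // ji; rewrite ji (negbTE iJ) in jJ.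
have B'i : B' i = C by rewrite /B' eqxx.
have mB' j : j \in (i |` J)%fset -> measurable (B' j).
  by rewrite !inE => /orP[/eqP ->|jJ]; rewrite ?B'i // B'J //; exact: mB.
have E' : E `&` Z i @^-1` C = \bigcap_(j in [set` (i |` J)%fset]) (Z j @^-1` B' j).
  rewrite EB; apply/seteqP; split=> w /=.
    move=> [h wC] j /=; rewrite !inE => /orP[/eqP ->|jJ]; first by rewrite B'i.
    by rewrite B'J //; exact: h.
  move=> h; split; last by rewrite -B'i; apply: h => /=; rewrite !inE eqxx.
  by move=> j /= jJ; rewrite -B'J //; apply: h => /=; rewrite !inE jJ orbT.
split; first by exists B'.
rewrite E' (indep mB') big_fsetU1 //= B'i muleC EB (indep mB).
congr (_ * _)%E; apply: eq_big_seq => j jJ; by rewrite B'J.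
Qed.

Section CellChains.
Variables (I : finType) (C : I -> set (measurableTypeR R * measurableTypeR R)%type).
Variables (r : rel I) (p q : R) (F : I -> R).
Hypothesis mC : forall c, measurable (C c).
Hypothesis pC : forall i c, (P (Z i @^-1` C c) <= p%:E)%E.
Hypothesis q0 : 0 <= q.
Hypothesis F1 : forall c, 1 <= F c.
Hypothesis rF : forall c, \sum_(c' | r c c') p * F c' <= q * F c.

Fixpoint cell_chain (s : seq nat) (c : I) : set T :=
  if s is i :: s' then
    \bigcup_(c' in [set c' | r c c']) (Z i @^-1` C c' `&` cell_chain s' c')
  else setT.

Lemma measurable_cell_chain s c : measurable (cell_chain s c).
Proof.
elim: s c => [|i s ih] c /=; first exact: measurableT.
apply: fin_bigcup_measurable => // c' _.
by apply: measurableI => //; exact: measurable_preimage_point.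
Qed.

(** By [rF], [F] is a supersolution for the transfer operator of [r]: one step multiplies it by at
    most [q], and [F1] ends the recursion. The event [E] collects the cells already prescribed;
    since [s] has no repetition, each next cell concerns a fresh index and its probability factors
    out. *)
Lemma cell_chain_cylinder_le s c J E : uniq s -> cylinder J E ->
  (forall i, i \in s -> i \notin J) ->
  (P (E `&` cell_chain s c) <= P E * (q ^+ size s * F c)%:E)%E.
Proof.
elim: s c J E => [|i s ih] c J E /=.
  move=> _ cE _; rewrite setIT expr0 mul1r.
  by rewrite -[leLHS]mule1 lee_pmul // ?lee_fin.
move=> /andP[nis us] cE sJ.
have mE := measurable_cylinder cE.
have cEi c' := cylinderI cE (sJ i (mem_head _ _)) (mC c').
apply: le_trans (_ : (\sum_(c' | r c c')
    P ((E `&` Z i @^-1` C c') `&` cell_chain s c') <= _)%E).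
  apply: measure_fin_cover.
  - apply: measurableI => //; apply: fin_bigcup_measurable => // c' _.
    by apply: measurableI; [exact: measurable_preimage_point|exact: measurable_cell_chain].
  - move=> c' _; apply: measurableI; last exact: measurable_cell_chain.
    exact: measurable_cylinder (cEi c').1.
  - by move=> w [wE [c' rc [wC ws]]]; exists c'.
have PE : P E = (fine (P E))%:E by rewrite fineK // fin_num_measure.
have PE0 : 0 <= fine (P E) by exact: fine_ge0.
apply: le_trans (_ : (\sum_(c' | r c c')
    (fine (P E) * p * (q ^+ size s * F c'))%:E <= _)%E).
  apply: lee_sum => c' rc.
  apply: le_trans (ih c' _ _ us (cEi c').1 _) _.
    move=> j js; rewrite !inE negb_or sJ ?inE ?js ?orbT // andbT.
    by apply: contraNneq nis => <-.
  have F0 : 0 <= q ^+ size s * F c'.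
    by rewrite mulr_ge0 ?exprn_ge0 // (le_trans ler01).
  rewrite [leRHS]EFinM lee_wpmul2r ?lee_fin // (cEi c').2 PE [leRHS]EFinM.
  by rewrite lee_wpmul2l ?lee_fin.
rewrite sumEFin PE -EFinM lee_fin.
have -> : \sum_(c' | r c c') fine (P E) * p * (q ^+ size s * F c')
    = fine (P E) * (q ^+ size s * \sum_(c' | r c c') p * F c').
  by rewrite !mulr_sumr; apply: eq_bigr => c' _; ring.
rewrite ler_wpM2l // exprSr -mulrA ler_wpM2l ?exprn_ge0 //.
Qed.

Lemma cell_chain_le s c : uniq s -> (P (cell_chain s c) <= (q ^+ size s * F c)%:E)%E.
Proof.
move=> us; have := cell_chain_cylinder_le c us cylinder_setT.
by rewrite setTI probability_setT mul1e; exact.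
Qed.

End CellChains.
End Cylinders.

(** * Boxes under the uniform law on the rectangle *)

Section Boxes.
Variable R : realType.

(** Half-open in both coordinates, so that truncating the rescaled coordinates of a point gives a
    box that contains it. *)
Definition box (a b c e : R) : set (measurableTypeR R * measurableTypeR R)%type :=
  `[a, b[ `*` `[c, e[.

Lemma measurable_box a b c e : measurable (box a b c e).
Proof. by apply: measurableX; exact: measurable_itv. Qed.

Lemma measurable_Lambda (t x : R) : measurable (Lambda t x).
Proof. by apply: measurableX; exact: measurable_itv. Qed.

Lemma plane_measure_itvX (I J : interval R) :
  plane_measure ([set` I] `*` [set` J]) =
  (lebesgue_measure ([set` I] : set R) * lebesgue_measure ([set` J] : set R))%E.
Proof. by apply: product_measure1E; exact: measurable_itv. Qed.

Lemma plane_measure_box (a b c e : R) : a <= b -> c <= e ->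
  plane_measure (box a b c e) = ((b - a) * (e - c))%:E.
Proof.
move=> ab ce; rewrite /box plane_measure_itvX !lebesgue_measure_itv /= !lte_fin.
have len (u v : R) : u <= v ->
    (if (u < v)%R then (v%:E - u%:E)%E else 0%E) = (v - u)%:E.
  by rewrite le_eqVlt => /orP[/eqP ->|->]; rewrite ?ltxx ?subrr // EFinB.
by rewrite !len // EFinM.
Qed.

Lemma plane_measure_Lambda (t x : R) : 0 < t -> 0 < x ->
  plane_measure (Lambda t x) = (2 * (t * x))%:E.
Proof.
move=> t0 x0; rewrite /Lambda plane_measure_itvX !lebesgue_measure_itv /= !lte_fin.
rewrite t0 ifT; last by lra.
by rewrite -!EFinB -EFinM; congr (_%:E); ring.
Qed.

Section InSample.
Context (d : measure_display) (T : measurableType d).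
Variable P : probability T R.
Variables (t x : R) (X : {RV P >-> (measurableTypeR R * measurableTypeR R)%type}).
Hypotheses (t0 : 0 < t) (x0 : 0 < x) (uX : uniform_on (Lambda t x) X).

(** An inequality only, since a grid cell may stick out of [Lambda t x]. *)
Lemma prob_box_le a b c e : a <= b -> c <= e ->
  (P (X @^-1` box a b c e) <= ((b - a) * (e - c) / (2 * (t * x)))%:E)%E.
Proof.
move=> ab ce; rewrite uX; last exact: measurable_box.
rewrite plane_measure_Lambda //= muleC EFinM; apply: lee_wpmul2r.
  by rewrite lee_fin invr_ge0 !mulr_ge0 ?ltW.
rewrite -(plane_measure_box ab ce); apply: le_measure; rewrite ?inE.
- by apply: measurableI; [exact: measurable_box|exact: measurable_Lambda].
- exact: measurable_box.
- exact: subIsetl.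
Qed.

Lemma prob_box_sub a b c e : a <= b -> c <= e -> box a b c e `<=` Lambda t x ->
  P (X @^-1` box a b c e) = ((b - a) * (e - c) / (2 * (t * x)))%:E.
Proof.
move=> ab ce sub; rewrite uX; last exact: measurable_box.
rewrite setIidl // plane_measure_Lambda //= plane_measure_box //.
by rewrite -EFinM mulrC.
Qed.

Lemma prob_notin_Lambda : P (X @^-1` (~` Lambda t x)) = 0%E.
Proof.
rewrite uX; last by apply: measurableC; exact: measurable_Lambda.
by rewrite setICl /plane_measure measure0 mule0.
Qed.

End InSample.
End Boxes.

(** * Upper tail bound: grid, decoupling of the steps, choice of parameters *)

Section UpperBound.
Context (d : measure_display) (T : measurableType d) (R : realType).
Variable P : probability T R.
Variable Z : nat -> {RV P >-> (measurableTypeR R * measurableTypeR R)%type}.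
Variables (t x A gamma : R).
Hypotheses (t0 : 0 < t) (x0 : 0 < x) (A0 : 0 < A) (gamma0 : 0 <= gamma).
Hypothesis iid : iid_uniform (Lambda t x) Z.

(* [h], the height of a cell, is the increment that the Hoelder condition allows
   over one slot of length [delta]. *)
Section Grid.
Variables (N : nat) (z : R).
Hypotheses (N0 : (0 < N)%N) (z0 : 0 < z) (z1 : z <= 1).

Let delta := t / N%:R.
Let h := A * delta `^ gamma.
Let M := Num.truncn (2 * x / h).

(** Time [t] has column index [N], and the last row covers the remainder of the height [2 x]; hence
    the successors in the index types. *)
Definition grid_cell (c : 'I_N.+1 * 'I_M.+1) :=
  box (c.1%:R * delta) (c.1.+1%:R * delta)
      (- x + c.2%:R * h) (- x + c.2.+1%:R * h).

(** A necessary condition for a Hoelder step between two cells. The times differ by less than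
    [D = c'.1 - c.1 + 1] slots, so the heights differ by at most [h D^gamma]; the added 1 accounts
    for the positions inside the cells. *)
Definition grid_step (c c' : 'I_N.+1 * 'I_M.+1) : bool :=
  (c.1 <= c'.1)%N &&
  (`|c'.2%:R - c.2%:R| <= (c'.1 - c.1).+1%:R `^ gamma + 1 :> R).

Let delta0 : 0 < delta. Proof. by rewrite divr_gt0 // ltr0n. Qed.
Let h0 : 0 < h. Proof. by rewrite mulr_gt0 // powR_gt0. Qed.

Lemma grid_step_holder c c' (u v : R * R) : grid_cell c u -> grid_cell c' v ->
  holder_step gamma A u v -> grid_step c c'.
Proof.
move=> [/= + +] [/= + +] /andP[uv huv].
rewrite !in_itv /= => /andP[u1 u2] /andP[u3 u4] /andP[v1 v2] /andP[v3 v4].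
have jj : (c.1 <= c'.1)%N.
  rewrite leqNgt; apply/negP => lt.
  have : c'.1.+1%:R * delta <= c.1%:R * delta by rewrite ler_pM2r // ler_nat.
  lra.
rewrite /grid_step jj /=; set D := (c'.1 - c.1).+1.
have DE : D%:R = c'.1.+1%:R - c.1%:R :> R by rewrite /D -subSn // natrB // ltnW.
have dt : v.1 - u.1 <= D%:R * delta by rewrite DE mulrBl; lra.
have hD : A * (v.1 - u.1) `^ gamma <= h * D%:R `^ gamma.
  rewrite /h -mulrA ler_pM2l // -powRM ?(ltW delta0) // mulrC ge0_ler_powR //.
  - by rewrite nnegrE; lra.
  - by rewrite nnegrE mulr_ge0 // ltW.
have {hD}huv := le_trans huv hD.
have key (a b : nat) : (a.+1%:R - b%:R - 2%:R) * h < h * D%:R `^ gamma ->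
    a%:R - b%:R <= D%:R `^ gamma + 1 :> R.
  by rewrite mulrC ltr_pM2l // -natr1 => ?; lra.
rewrite ler_norml; apply/andP; split.
  rewrite lerNl opprB; apply: key; move: huv; rewrite ler_norml => /andP[+ _].
  by move: u3 v4; rewrite -!natr1; nra.
apply: key; move: huv; rewrite ler_norml => /andP[_].
by move: u4 v3; rewrite -!natr1; nra.
Qed.

Lemma grid_cover (u : measurableTypeR R * measurableTypeR R) :
  Lambda t x u -> exists c, grid_cell c u.
Proof.
move=> [/=]; rewrite !in_itv /= => /andP[a1 a2] /andP[b1 b2].
have ud : 0 <= u.1 / delta by rewrite divr_ge0 // ltW.
have vh : 0 <= (u.2 + x) / h by rewrite divr_ge0 ?(ltW h0) //; lra.
have jN : (Num.truncn (u.1 / delta)  < N.+1)%N.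
  rewrite ltnS -(ler_nat R); apply: le_trans (_ : u.1 / delta <= _).
    by have /andP[] := truncn_itv ud.
  rewrite ler_pdivrMr // /delta mulrCA divff ?mulr1 //.
  by rewrite pnatr_eq0 -lt0n.
have lM : (Num.truncn ((u.2 + x) / h) < M.+1)%N.
  rewrite ltnS; apply: le_truncn; rewrite ler_pM2r ?invr_gt0 //; lra.
exists (Ordinal jN, Ordinal lM).
have /andP[c1 c2] := truncn_itv ud; have /andP[c3 c4] := truncn_itv vh.
split; rewrite /= in_itv /=; apply/andP; split.
- by rewrite -ler_pdivlMr.
- by rewrite -ltr_pdivrMr.
- by rewrite addrC -lerBrDr opprK -ler_pdivlMr.
- by rewrite addrC -ltrBlDr opprK -ltr_pdivrMr.
Qed.

Lemma sample_path_grid c s (p : T -> R * R) w : grid_cell c (p w) ->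
  (forall i, i \in s -> Lambda t x (Z i w)) ->
  path (holder_step gamma A) (p w) [seq (Z i w : R * R) | i <- s] ->
  cell_chain Z grid_cell grid_step s c w.
Proof.
elim: s c p => [//|i s ih] c p /= cp sL /andP[pi ps].
have [c' c'i] := grid_cover (sL i (mem_head _ _)).
exists c' => /=; first exact: grid_step_holder cp c'i pi.
split=> //; apply: (ih c' (Z i)) => //.
by move=> j js; apply: sL; rewrite inE js orbT.
Qed.

Definition weight_sum := \sum_(i < N.+1) i.+1%:R `^ gamma * z ^+ i.

Lemma weight_sum_ge0 : 0 <= weight_sum.
Proof.
by apply: sumr_ge0 => i _; rewrite mulr_ge0 ?powR_ge0 // exprn_ge0 ?(ltW z0).
Qed.

(** With [D] the power [(i + 1)^gamma], an increment of [i] slots leaves at most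
    [2 (D + 1) + 1 <= 5 D] rows, since [D >= 1]. The weight [z ^+ c'.1] splits into that of [c] and
    that of the increment, so the sum over increments no longer depends on [c]. *)
Lemma grid_step_sum c : \sum_(c' | grid_step c c') z ^+ c'.1 <= 5 * weight_sum * z ^+ c.1.
Proof.
pose g i : R := 5 * (i.+1%:R `^ gamma * z ^+ i) * z ^+ c.1.
have g0 i : 0 <= g i.
  by rewrite /g !mulr_ge0 ?powR_ge0 ?exprn_ge0 ?(ltW z0).
rewrite /grid_step -(pair_big_dep (fun j' : 'I_N.+1 => c.1 <= j')%N
  (fun j' (l' : 'I_M.+1) => `|l'%:R - c.2%:R| <= (j' - c.1).+1%:R `^ gamma + 1 :> R)
  (fun j' _ => z ^+ j')) /=.
apply: le_trans (_ : \sum_(j' < N.+1 | (c.1 <= j')%N) g (j' - c.1)%N <= _).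
  apply: ler_sum => j' jj'.
  rewrite (eq_bigr (fun=> z ^+ j' * 1)); last by move=> *; rewrite mulr1.
  rewrite -mulr_sumr /g -[in leRHS](mulrA 5) -(mulrA (_ `^ _)) -exprD subnK //.
  rewrite mulrA [leRHS]mulrC ler_wpM2l ?exprn_ge0 ?(ltW z0) //.
  set D := _ `^ gamma.
  have D1 : 1 <= D.
    by rewrite /D -[leLHS](powRr0 (j' - c.1).+1%:R) ler_powR // ler1n.
  apply: le_trans (count_near_le _ _ _) _; lra.
rewrite -(big_geq_mkord c.1 N.+1 xpredT (fun j' => g (j' - c.1)%N)) /=.
rewrite -{1}[nat_of_ord c.1]add0n big_addn big_mkord.
rewrite /weight_sum mulr_sumr mulr_suml.
under eq_bigr do rewrite addnK.
rewrite (big_ord_widen N.+1 g) ?leq_subr // big_mkcond /=.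
by apply: ler_sum => i _; case: ifP => _; [rewrite /g|exact: g0].
Qed.

Let p := delta * h / (2 * (t * x)).

Let p0 : 0 <= p.
Proof. exact/ltW/(divr_gt0 (mulr_gt0 delta0 h0) (mulr_gt0 (@ltr0Sn R 1) (mulr_gt0 t0 x0))). Qed.

Let q0 : 0 <= 5 * (p * weight_sum).
Proof. exact: mulr_ge0 (ler0n _ 5) (mulr_ge0 p0 weight_sum_ge0). Qed.

Lemma prob_grid_cell i c : (P (Z i @^-1` grid_cell c) <= p%:E)%E.
Proof.
apply: le_trans (prob_box_le t0 x0 (iid.1 i) _ _) _.
- by rewrite ler_pM2r // ler_nat.
- by rewrite lerD2l ler_pM2r // ler_nat.
rewrite lee_fin le_eqVlt; apply/orP; left; apply/eqP.
by rewrite /p -!natr1; congr (_ / _); ring.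
Qed.

Lemma prob_grid_chain s c : uniq s ->
  (P (cell_chain Z grid_cell grid_step s c)
     <= ((5 * (p * weight_sum)) ^+ size s * z^-1 ^+ N)%:E)%E.
Proof.
move=> us; have zi1 : 1 <= z^-1 by rewrite invf_ge1.
(* The factor [z^-1 ^+ N] makes [F >= 1], because column indices are at most [N]. *)
pose F (c' : 'I_N.+1 * 'I_M.+1) := z ^+ c'.1 * z^-1 ^+ N.
apply: le_trans (@cell_chain_le _ _ _ P Z iid.2 _ grid_cell grid_step p
  (5 * (p * weight_sum)) F _ _ _ _ _ s c us) _.
- by move=> c'; exact: measurable_box.
- exact: prob_grid_cell.
- exact: q0.
- move=> c'; rewrite /F exprVn ler_pdivlMr ?exprn_gt0 // mul1r.
  by rewrite ler_wiXn2l ?(ltW z0) // -ltnS.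
- move=> c'; rewrite /F -mulr_sumr -mulr_suml.
  have -> : 5 * (p * weight_sum) * (z ^+ c'.1 * z^-1 ^+ N)
    = p * (5 * weight_sum * z ^+ c'.1 * z^-1 ^+ N) by ring.
  by rewrite ler_wpM2l // ler_wpM2r ?exprn_ge0 ?invr_ge0 ?(ltW z0) // grid_step_sum.
rewrite lee_fin ler_wpM2l ?exprn_ge0 ?q0 //.
by rewrite /F ler_piMl ?exprn_ge0 ?invr_ge0 ?(ltW z0) // exprn_ile1 // ltW.
Qed.

Lemma holder_lpp_grid_le m k :
  (P [set w | (k <= holder_lpp gamma A Z m w)%N]
     <= ((m%:R * (5 * (p * weight_sum))) ^+ k * z^-1 ^+ N)%:E)%E.
Proof.
have [c0 c0P] : exists c, grid_cell c (0, 0).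
  by apply: grid_cover; split; rewrite /= in_itv /= ?lexx ?oppr_le0 ?(ltW t0) ?(ltW x0).
pose bound : R := (5 * (p * weight_sum)) ^+ k * z^-1 ^+ N.
(* The events on the left are null: they remove samples with a point outside [Lambda t x], which the
   grid need not cover. *)
pose E (u : 'I_m + k.-tuple 'I_m) : set T := match u with
  | inl i => Z i @^-1` (~` Lambda t x)
  | inr s => cell_chain Z grid_cell grid_step [seq val i | i <- s] c0 end.
pose Q (u : 'I_m + k.-tuple 'I_m) := match u with
  | inl _ => true | inr s => uniq [seq val i | i <- s] end.
have mE u : Q u -> measurable (E u).
  case: u => [i|s] _ /=.
    by apply: measurable_preimage_point; apply: measurableC; exact: measurable_Lambda.
  by apply: measurable_cell_chain => c; exact: measurable_box.
have mL := @measurable_holder_lpp_ge _ _ _ P Z gamma A (ltW A0) m k.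
apply: le_trans (@measure_fin_cover _ _ _ P _ Q _ E mL mE _) _.
  rewrite holder_lpp_geE ?(ltW A0) // => w [s _ /= sp].
  have [sL|] := pselect (forall i, i \in [seq val i | i <- s] -> Lambda t x (Z i w)).
    exists (inr s) => /=; first exact: sample_path_uniq sp.
    exact: (sample_path_grid (p := fun=> (0, 0))) c0P sL sp.
  move=> /existsNP[_ /not_implyP[/mapP[i _ ->] nL]].
  by exists (inl i).
rewrite big_sumType /= big1 ?add0e; last first.
  by move=> i _; apply: prob_notin_Lambda; exact: iid.1.
apply: le_trans (_ : (\sum_(s : k.-tuple 'I_m | uniq [seq val i | i <- s]) bound%:E <= _)%E).
  apply: lee_sum => s us; apply: le_trans (prob_grid_chain _ us) _.
  by rewrite size_map size_tuple.
have -> : (m%:R * (5 * (p * weight_sum))) ^+ k * z^-1 ^+ N = m%:R ^+ k * bound.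
  by rewrite /bound [in LHS]exprMn [RHS]mulrA.
rewrite sumEFin lee_fin sumr_const -[leLHS]mulr_natl; apply: ler_wpM2r.
  by rewrite mulr_ge0 ?exprn_ge0 ?invr_ge0 ?(ltW z0) ?q0.
rewrite -natrX ler_nat; apply: leq_trans (max_card _) _.
by rewrite card_tuple card_ord.
Qed.

End Grid.

(** With [N = k n^2] slots the cost [z^-1 ^+ N] is at most [e^n] per step, as [weight_le] expects.
    The constant is [15 = 6 * 5 / 2], where 5 counts rows and 2 comes from the area [2 t x]. *)
Lemma holder_lpp_ge_le m k : (0 < k)%N ->
  (P [set w | (k <= holder_lpp gamma A Z m w)%N]
     <= ((15 * expR 2 * (1 + gamma) `^ (- 2^-1) * A * t `^ gamma * m%:R
          / (x * k%:R `^ (1 + gamma))) ^+ k)%:E)%E.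
Proof.
move=> k0; set n := (Num.truncn gamma).+1.
pose N := (k * (n * n))%N; pose z : R := n%:R / n.+1%:R.
have N0 : (0 < N)%N by rewrite !muln_gt0 k0.
have n0 : 0 < n%:R :> R by [].
have z0 : 0 < z by rewrite divr_gt0.
have z1 : z <= 1 by rewrite ler_pdivrMr // mul1r ler_nat.
apply: le_trans (holder_lpp_grid_le N0 z0 z1 m k) _.
have zN : z^-1 ^+ N <= expR n%:R ^+ k.
  have -> : expR n%:R ^+ k = expR n%:R^-1 ^+ N :> R.
    rewrite -!expRM_natl /N !natrM; congr expR; field.
    by rewrite gt_eqF.
  rewrite lerXn2r ?nnegrE ?expR_ge0 ?invr_ge0 ?(ltW z0) //.
  rewrite /z invf_div -[n.+1%:R]natr1 mulrDl divff ?gt_eqF // mul1r.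
  exact: expR_ge1Dx.
have k1 : 0 < k%:R :> R by rewrite ltr0n.
set S := weight_sum N z; have S0 : 0 <= S := weight_sum_ge0 N z0.
set dl := t / N%:R; have dl0 : 0 < dl by rewrite divr_gt0 // ltr0n.
set p := dl * (A * dl `^ gamma) / (2 * (t * x)).
have p0 : 0 <= p.
  exact/ltW/(divr_gt0 (mulr_gt0 dl0 (mulr_gt0 A0 (powR_gt0 _ dl0))) (mulr_gt0 (@ltr0Sn R 1) (mulr_gt0 t0 x0))).
rewrite lee_fin.
apply: le_trans (_ : (m%:R * (5 * (p * S))) ^+ k * expR n%:R ^+ k <= _).
  by rewrite ler_wpM2l // exprn_ge0 // mulr_ge0 // mulr_ge0 // mulr_ge0.
set c1 := _ * m%:R / _.
have c10 : 0 <= c1.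
  rewrite /c1 divr_ge0 //; last by rewrite mulr_ge0 ?powR_ge0 ?(ltW x0).
  by rewrite !mulr_ge0 ?powR_ge0 ?expR_ge0 ?(ltW A0).
have q0 : 0 <= m%:R * (5 * (p * S)) * expR n%:R.
  by rewrite mulr_ge0 ?expR_ge0 // mulr_ge0 // mulr_ge0 // mulr_ge0.
rewrite -exprMn; apply: lerXn2r; rewrite ?nnegrE //.
rewrite /c1 => {q0 c10}.
have W := weight_le N.+1 gamma0; rewrite -/n -/z -/(weight_sum N z) -/S in W.
set n' := n%:R `^ _ in W; have n'0 : 0 < n' by rewrite powR_gt0.
set k' := k%:R `^ _; have k'0 : 0 < k' by rewrite powR_gt0.
set tg := t `^ gamma; have tg0 : 0 < tg by rewrite powR_gt0.
(* The area of a cell is [A] times this product. It supplies [k^(1 + gamma)] and the denominator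
   [n^(2 (1 + gamma))] of [weight_le]. *)
have dlE : dl * dl `^ gamma = t * tg / (k' * n').
  have pow1 (a : R) : 0 < a -> a * a `^ gamma = a `^ (1 + gamma).
    by move=> a0; rewrite powRD ?powRr1 ?(ltW a0) // (gt_eqF a0) implybT.
  rewrite !pow1 // /dl powRM ?(ltW t0) ?invr_ge0 // -powR_inv1 // powRAC powR_inv1 ?powR_ge0 //.
  rewrite /N !natrM !powRM ?mulr_ge0 // /n' powRrM.
  by rewrite powR_mulrn // -expr2 [_ `^ _ ^+ 2]expr2 -powRM.
have pE : p = A * (t * tg / (k' * n')) / (2 * (t * x)).
  by rewrite /p [dl * (A * _)]mulrCA dlE.
have -> : m%:R * (5 * (p * S)) * expR n%:R
    = 5 / 2 * m%:R * A * tg / (x * k') * (expR n%:R * S / n').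
  rewrite pE; field.
  by rewrite !gt_eqF.
have -> : 15 * expR 2 * (1 + gamma) `^ (- 2^-1) * A * tg * m%:R / (x * k')
    = 5 / 2 * m%:R * A * tg / (x * k') * (6 * expR 2 * (1 + gamma) `^ (- 2^-1)).
  by field; rewrite !gt_eqF.
apply: ler_wpM2l W.
by rewrite divr_ge0 ?mulr_ge0 // ltW.
Qed.

End UpperBound.

(** * Lower tail bound through empty slots *)

Lemma measure_fin_disjoint (d : measure_display) (T : measurableType d) (R : realType)
    (mu : {measure set T -> \bar R}) (I : finType) (S : {set I}) (F : I -> set T) :
  (forall i, i \in S -> measurable (F i)) -> trivIset [set` S] F ->
  mu (\bigcup_(i in [set` S]) F i) = (\sum_(i in S) mu (F i))%E.
Proof.
move=> mF tF; rewrite measure_fin_bigcup //.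
rewrite (fsbigE (enum S)) ?enum_uniq //.
- by rewrite big_enum_cond /=; apply: eq_bigl => i; rewrite mem_setE andbb.
- by move=> i /=; rewrite mem_enum.
- by move=> i /= Qi; rewrite mem_enum Qi.
Qed.

Section AllAvoid.
Context (d : measure_display) (T : measurableType d) (R : realType).
Variable P : probability T R.
Variable Z : nat -> {RV P >-> (measurableTypeR R * measurableTypeR R)%type}.

Lemma prob_all_in_le (B : set (measurableTypeR R * measurableTypeR R)%type) (v : R) m :
  mutually_independent Z -> measurable B -> 0 <= v ->
  (forall i, (P (Z i @^-1` B) <= v%:E)%E) ->
  measurable [set w | forall i, (i < m)%N -> B (Z i w)] /\
  (P [set w | forall i, (i < m)%N -> B (Z i w)] <= (v ^+ m)%:E)%E.
Proof.
move=> indep mB v0 PB.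
(* The indices of the cylinder are kept below [m], so that the next index [m] is fresh. *)
suff [J [cJ [_ Pm]]] : exists J, cylinder Z J [set w | forall i, (i < m)%N -> B (Z i w)] /\
    ((forall i, i \in J -> (i < m)%N) /\
    (P [set w | forall i, (i < m)%N -> B (Z i w)] <= (v ^+ m)%:E)%E).
  by split=> //; exact: measurable_cylinder cJ.
elim: m => [|m [J [cJ [Jm Pm]]]].
  rewrite (_ : [set _ | _] = setT); last by apply/seteqP; split.
  exists fset0; split; first exact: cylinder_setT.
  by split=> //; rewrite expr0 probability_le1.
have -> : [set w | forall i, (i < m.+1)%N -> B (Z i w)] =
    [set w | forall i, (i < m)%N -> B (Z i w)] `&` Z m @^-1` B.
  apply/seteqP; split=> w /=.
    by move=> h; split=> [i im|]; apply: h => //; exact: ltnW.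
  by move=> [h hm] i; rewrite ltnS leq_eqVlt => /orP[/eqP ->|/h].
have mJ : m \notin J by apply/negP => /Jm; rewrite ltnn.
have [cJ' PJ'] := cylinderI indep cJ mJ mB.
exists (m |` J)%fset; split=> //; split.
  by move=> i; rewrite !inE => /orP[/eqP ->//|/Jm/ltnW].
by rewrite PJ' exprSr EFinM lee_pmul.
Qed.

End AllAvoid.

Section LowerBound.
Context (d : measure_display) (T : measurableType d) (R : realType).
Variable P : probability T R.
Variable Z : nat -> {RV P >-> (measurableTypeR R * measurableTypeR R)%type}.
Variables (t x A gamma : R).
Hypotheses (t0 : 0 < t) (x0 : 0 < x) (A0 : 0 < A) (gamma0 : 0 <= gamma).
Hypothesis iid : iid_uniform (Lambda t x) Z.
Variables (k m : nat).
Hypothesis k0 : (0 < k)%N.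

(* Every other slot of length t / 4k is used, so that points of distinct slots
   are at time distance at least tau, as are all these points from the origin. *)
Let tau := t / (4 * k)%:R.
Let c := Num.min (A * tau `^ gamma / 2) x.

Definition slot (a : nat) :=
  box ((2 * a).+1%:R * tau) ((2 * a).+2%:R * tau) (- c) c.

Let tau0 : 0 < tau. Proof. by rewrite divr_gt0 // ltr0n muln_gt0. Qed.
Let c0 : 0 < c.
Proof. by rewrite lt_min x0 divr_gt0 // mulr_gt0 // powR_gt0. Qed.

(** Two heights in the strip differ by at most [2 c <= A tau^gamma], while the times differ by at
    least [tau]. *)
Lemma holder_step_slot (u v : R * R) a :
  u.1 <= (2 * a)%:R * tau -> `|u.2| <= c -> slot a v -> holder_step gamma A u v.
Proof.
move=> u1 u2 [/= + +]; rewrite !in_itv /= => /andP[v1 v2] /andP[v3 v4].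
have dt : tau <= v.1 - u.1 by move: v1; rewrite -natr1 mulrDl; lra.
apply/andP; split; first lra.
have cA : c + c <= A * tau `^ gamma.
  have : c <= A * tau `^ gamma / 2 by rewrite ge_min lexx.
  lra.
apply: le_trans (ler_normB _ _) _.
apply: le_trans (_ : A * tau `^ gamma <= _).
  apply: le_trans cA; rewrite lerD // ler_norml v3 ltW //.
by rewrite ler_pM2l // ge0_ler_powR // nnegrE ltW //; lra.
Qed.

Lemma sample_path_slots (f : nat -> nat) l (u : R * R) w :
  (forall a, a \in l -> u.1 <= (2 * a)%:R * tau) -> `|u.2| <= c ->
  sorted ltn l -> (forall a, a \in l -> slot a (Z (f a) w)) ->
  path (holder_step gamma A) u [seq (Z (f a) w : R * R) | a <- l].
Proof.
elim: l u => [//|a l ih] u /= u1 u2 al sl.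
have sa := sl a (mem_head _ _).
rewrite (holder_step_slot (u1 a (mem_head _ _)) u2 sa) /=.
have [] := sa; rewrite /= !in_itv /= => /andP[v1 v2] /andP[v3 v4].
apply: ih.
- move=> a' la'; have : (a < a')%N.
    by move: al; rewrite (path_sortedE ltn_trans) => /andP[/allP/(_ _ la')].
  move=> aa'; apply: le_trans (ltW v2) _.
  rewrite ler_pM2r // ler_nat; have -> : (2 * a).+2 = (2 * a.+1)%N by rewrite mulnS.
  by rewrite leq_pmul2l.
- by rewrite ler_norml v3 ltW.
- exact: path_sorted al.
- by move=> a' la'; apply: sl; rewrite inE la' orbT.
Qed.

Definition hit_slots w : {set 'I_(2 * k)} :=
  [set a : 'I_(2 * k) | `[< exists2 i, (i < m)%N & slot a (Z i w) >]].

Lemma card_hit_slots_le w : (#|hit_slots w| <= holder_lpp gamma A Z m w)%N.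
Proof.
pose hit a i := (i < m)%N /\ slot a (Z i w).
pose f a := xget 0%N (hit a).
pose l := [seq val a | a <- enum (hit_slots w)].
have fl a : a \in l -> hit a (f a).
  move=> /mapP[b]; rewrite mem_enum inE => /asboolP[i im si] ->.
  by apply: (@xgetPex _ 0%N (hit b)); exists i.
have sl : size [seq f a | a <- l] = #|hit_slots w| by rewrite !size_map cardE.
rewrite -sl; apply: sample_path_leq; first exact: ltW.
  by apply/allP => j /mapP[a /fl[fm _] ->].
rewrite /sample_path -map_comp; apply: sample_path_slots.
- by move=> a _; rewrite mulr_ge0 // ltW.
- by rewrite normr0 ltW.
- rewrite /l /enum_mem -enumT; apply: (subseq_sorted ltn_trans) (iota_ltn_sorted 0 (2 * k)).
  by rewrite -val_enum_ord; apply: map_subseq; exact: filter_subseq.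
- by move=> a /fl[].
Qed.

Lemma prob_slots (S : {set 'I_(2 * k)}) i :
  measurable (\bigcup_(a in [set` S]) slot a) /\
  P (Z i @^-1` (\bigcup_(a in [set` S]) slot a)) =
  (#|S|%:R * (c / (4 * k%:R * x)))%:E.
Proof.
have ms (a : 'I_(2 * k)) : measurable (slot a) by exact: measurable_box.
split; first by apply: fin_bigcup_measurable.
rewrite preimage_bigcup measure_fin_disjoint; last 2 first.
- by move=> a _; exact: measurable_preimage_point.
- move=> a b _ _ [w []]; rewrite /slot /box /= => -[/= + _] [/= + _].
  rewrite !in_itv /= => /andP[a1 a2] /andP[b1 b2].
  have lt (u v : nat) : (2 * u).+1%:R * tau < (2 * v).+2%:R * tau -> (u <= v)%N.
    by rewrite ltr_pM2r // ltr_nat !ltnS leq_pmul2l.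
  have ab : (a <= b)%N by apply: lt; exact: le_lt_trans a1 b2.
  have ba : (b <= a)%N by apply: lt; exact: le_lt_trans b1 a2.
  by apply/val_inj/eqP; rewrite eqn_leq ab ba.
rewrite (eq_bigr (fun=> (c / (4 * k%:R * x))%:E)).
  by rewrite sumEFin sumr_const; congr (_%:E); rewrite -[LHS]mulr_natl.
move=> a _; apply: etrans (prob_box_sub t0 x0 (iid.1 i) _ _ _) _; last first.
- congr (_%:E); rewrite -mulrBl -[(2 * a).+2%:R]natr1 addrAC subrr add0r mul1r.
  rewrite /tau natrM; field.
  by rewrite !gt_eqF // ltr0n.
- have cx : c <= x by rewrite ge_min lexx orbT.
  move=> u [/= + +]; rewrite !in_itv /= => /andP[u1 u2] /andP[u3 u4].
  split; rewrite /= in_itv /=; last by apply/andP; split; lra.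
  apply/andP; split; first by apply: le_trans u1; rewrite mulr_ge0 // ltW.
  apply: le_trans (ltW u2) _; rewrite /tau mulrCA ger_pMr //.
  rewrite ler_pdivrMr ?ltr0n ?muln_gt0 // mul1r ler_nat.
  have -> : (2 * a).+2 = (2 * a.+1)%N by rewrite mulnS.
  have -> : (4 * k = 2 * (2 * k))%N by rewrite mulnA.
  by rewrite leq_pmul2l.
- by rewrite ge0_cp // ltW.
- by rewrite ler_pM2r // ler_nat.
Qed.

(** If the longest chain has at most [k] points, at least [k] of the [2 k] slots are empty. There
    are at most [2^(2 k)] choices of the set of empty slots, and one point avoids [k] given slots
    with probability [1 - c / (4 x)]. *)
Lemma holder_lpp_le_slots :
  (P [set w | (holder_lpp gamma A Z m w <= k)%N]
     <= (2 ^+ (2 * k) * expR (- (c / (4 * x))) ^+ m)%:E)%E.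
Proof.
pose B (S : {set 'I_(2 * k)}) := ~` (\bigcup_(a in [set` S]) slot a).
pose F S := [set w | forall i, (i < m)%N -> B S (Z i w)].
have mB S : measurable (B S).
  by apply: measurableC; exact: (prob_slots S 0).1.
pose v := expR (- (c / (4 * x))).
have PB (S : {set 'I_(2 * k)}) i : (k <= #|S|)%N -> (P (Z i @^-1` (B S)) <= v%:E)%E.
  move=> kS; rewrite /B preimage_setC probability_setC; last first.
    exact: (measurable_preimage_point Z i (prob_slots S 0).1).
  rewrite (prob_slots S i).2 -EFinB lee_fin.
  apply: le_trans (expR_ge1Dx _); rewrite lerD2l lerN2.
  have -> : c / (4 * x) = k%:R * (c / (4 * k%:R * x)).
    by field; rewrite !gt_eqF // ltr0n.
  by rewrite ler_wpM2r ?ler_nat // divr_ge0 ?mulr_ge0 // ltW.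
have PF (S : {set 'I_(2 * k)}) : (k <= #|S|)%N -> measurable (F S) /\ (P (F S) <= (v ^+ m)%:E)%E.
  move=> kS; apply: prob_all_in_le => //; [exact: iid.2|exact: expR_ge0|].
  by move=> i; exact: PB.
have mL := @measurable_holder_lpp_le _ _ _ P Z gamma A (ltW A0) m k.
apply: le_trans (@measure_fin_cover _ _ _ P _ (fun S : {set 'I_(2 * k)} => k <= #|S|)%N _ F mL _ _) _.
- by move=> S /PF[].
- move=> w /= Lk; exists (~: hit_slots w) => /=.
    rewrite cardsCs finset.setCK card_ord.
    by have := card_hit_slots_le w; move: Lk; set a := #|_|; set b := holder_lpp _ _ _ _ _; lia.
  move=> i im [a /= + sa]; rewrite !inE => /negP; apply.
  by apply/asboolP; exists i.
apply: le_trans (_ : (\sum_(S : {set 'I_(2 * k)} | (k <= #|S|)%N) (v ^+ m)%:E <= _)%E).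
  by apply: lee_sum => S /PF[].
rewrite sumEFin lee_fin sumr_const -[leLHS]mulr_natl ler_wpM2r ?exprn_ge0 ?expR_ge0 //.
rewrite -natrX ler_nat; apply: leq_trans (max_card _) _.
by rewrite -cardsT -powersetT card_powerset cardsT card_ord.
Qed.

Lemma holder_lpp_le_le (c2 := (32 * 4 `^ gamma)^-1) :
  (P [set w | (holder_lpp gamma A Z m w <= k)%N]
     <= (expR (c2 * k%:R *
          (1 - c2 * Num.min (A * t `^ gamma / (x * k%:R `^ gamma)) 1
                  * (m%:R / k%:R))))%:E)%E.
Proof.
set mu := Num.min _ 1; have k1 : 0 < k%:R :> R by rewrite ltr0n.
have f1 : 1 <= 4 `^ gamma :> R by rewrite -[leLHS](powRr0 4) ler_powR // ler1n.
have c20 : 0 < c2 by rewrite invr_gt0 mulr_gt0 // (lt_le_trans ltr01).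
have c21 : c2 <= 1 by rewrite invf_le1 ?mulr_gt0 // ?(lt_le_trans ltr01) //; lra.
have mu0 : 0 <= mu by rewrite le_min ler01 divr_ge0 ?mulr_ge0 ?powR_ge0 ?ltW.
have -> : c2 * k%:R * (1 - c2 * mu * (m%:R / k%:R)) = c2 * (k%:R - c2 * mu * m%:R).
  by field; rewrite gt_eqF.
(* In the first case the claimed bound is at least 1. In the second, [k < c2 mu m] lets the
   exponential decay absorb the factor [2^(2 k)]. *)
have [small|large] := leP (c2 * mu * m%:R) k%:R.
  apply: le_trans (probability_le1 _ (measurable_holder_lpp_le _ _ (ltW A0) _ _)) _.
  rewrite lee_fin; apply: le_trans (expR_ge1Dx _).
  by rewrite lerDl mulr_ge0 ?subr_ge0 // (ltW c20).
apply: le_trans holder_lpp_le_slots _; rewrite lee_fin.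
have two : 2 ^+ (2 * k) <= expR (2 * k%:R) :> R.
  rewrite -natrM -[(2 * k)%:R]mulr1 expRM_natl lerXn2r ?nnegrE ?expR_ge0 //.
  by apply: le_trans (expR_ge1Dx _); lra.
(* The [4 ^ gamma] comes from [tau = t / (4 k)]. The halves and quarters give
   [c / (4 x) >= mu / (8 * 4 ^ gamma)], and [32 = 4 * 8] leaves a spare factor 4. *)
have cmu : 4 * (c2 * mu) <= c / (4 * x).
  have -> : 4 * (c2 * mu) = mu / (2 * 4 `^ gamma) / 4.
    by rewrite /c2; field; rewrite gt_eqF // (lt_le_trans ltr01).
  have f0 := lt_le_trans ltr01 f1.
  have -> : c / (4 * x) = c / x / 4 by field; rewrite gt_eqF.
  rewrite ler_pM2r // ler_pdivlMr // /c le_min; apply/andP; split.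
    have -> : A * tau `^ gamma / 2
      = A * t `^ gamma / (x * k%:R `^ gamma) / (2 * 4 `^ gamma) * x.
      rewrite /tau natrM powRM ?(ltW t0) ?invr_ge0 ?mulr_ge0 // -powR_inv1 ?mulr_ge0 //.
      rewrite powRAC powR_inv1 ?powR_ge0 // powRM //; field.
      by rewrite !gt_eqF ?powR_gt0.
    rewrite !ler_pM2r ?invr_gt0 ?mulr_gt0 //.
    by rewrite ge_min lexx.
  rewrite ger_pMl // ler_pdivrMr ?mulr_gt0 //.
  have : mu <= 1 by rewrite ge_min lexx orbT.
  lra.
apply: le_trans (_ : expR (2 * k%:R) * expR (- (4 * (c2 * mu))) ^+ m <= _).
  apply: ler_pM => //; rewrite ?exprn_ge0 ?expR_ge0 //.
  by rewrite lerXn2r ?nnegrE ?expR_ge0 // ler_expR lerN2.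
rewrite -expRM_natl -expRD ler_expR.
have := mulr_ge0 (ltW c20) mu0; have := ler0n R m.
have : c2 * (c2 * mu * m%:R) <= c2 * mu * m%:R.
  by rewrite ler_piMl // !mulr_ge0 // ltW.
have : 0 <= c2 * k%:R by rewrite mulr_ge0 ?ltW.
move=> h1 h2 h3 h4; rewrite [leRHS]mulrBr; nra.
Qed.

End LowerBound.

(** * Almost sure order of the longest chain by Borel-Cantelli *)

Lemma ae_eventually_not (d : measure_display) (T : measurableType d) (R : realType)
    (P : probability T R) (E : nat -> set T) (z : R) :
  0 <= z < 1 -> (forall k, measurable (E k)) ->
  (forall k, (0 < k)%N -> (P (E k) <= (z ^+ k)%:E)%E) ->
  {ae P, forall w, exists k0 : nat, forall k, (k0 <= k)%N -> ~ E k w}.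
Proof.
move=> z01 mE PE; exists (lim_sup_set E); split.
- apply: bigcap_measurable => // n _; exact: bigcup_measurable.
- apply: lim_sup_set_cvg0 => //.
  apply: le_lt_trans (ltry ((1 - z)^-1)%R).
  apply: lime_le; first exact: is_cvg_nneseries.
  apply: nearW => n; rewrite big_mkord.
  apply: le_trans (_ : (\sum_(i < n) (z ^+ i)%:E <= _)%E).
    (* Nothing is assumed at [k = 0], where a probability is at most [1 = z ^+ 0]. *)
    apply: lee_sum => -[[|i] /= _] _; last exact: PE.
    by rewrite expr0 probability_le1.
  rewrite sumEFin lee_fin.
  have := sum_bin_geo_le 0 n z01; rewrite expr1.
  by under eq_bigr do rewrite bin0 mul1r.
- move=> w /= nw n _ /=; apply: contrapT => h; apply: nw; exists n => k nk Ek.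
  by apply: h; exists k.
Qed.

Section AlmostSureOrder.
Context (d : measure_display) (T : measurableType d) (R : realType).
Variable P : probability T R.
Variable Z : nat -> {RV P >-> (measurableTypeR R * measurableTypeR R)%type}.
Variables (t x A gamma : R).
Hypotheses (t0 : 0 < t) (x0 : 0 < x) (A0 : 0 < A) (gamma0 : 0 <= gamma).
Hypothesis iid : iid_uniform (Lambda t x) Z.

Let D := A * t `^ gamma / x.
Let g := 1 + gamma.
Let D0 : 0 < D. Proof. by rewrite divr_gt0 // mulr_gt0 // powR_gt0. Qed.
Let g0 : 0 < g. Proof. exact: ltr_pwDl ltr01 gamma0. Qed.

Let powRK (a : R) : 0 <= a -> (a `^ g^-1) `^ g = a.
Proof. by move=> a0; rewrite -powRrM mulVf ?gt_eqF // powRr1. Qed.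

(** The sample size [mk k] is chosen so that the upper tail bound is at most [2^- k]; this doubles
    the constant 15, the factor [(1 + gamma)^(-1/2)] being bounded by 1. Other sizes [m] follow by
    monotonicity. *)
Lemma ae_holder_lpp_upper : {ae P, forall w, exists m0 : nat, forall m : nat, (m0 <= m)%N ->
  (holder_lpp gamma A Z m w)%:R <= (30 * expR 2 * (D * m%:R)) `^ g^-1}.
Proof.
pose c := 30 * expR 2 * D.
have e0 : 0 < expR 2 :> R := expR_gt0 _.
have c0 : 0 < c := mulr_gt0 (mulr_gt0 (@ltr0Sn R 29) e0) D0.
have gp : g `^ (- 2^-1) <= 1.
  rewrite -[leRHS](powRr0 g) ler_powR // ?oppr_le0 ?invr_ge0 //.
  by rewrite lerDl.
pose mk k := Num.truncn (k%:R `^ g / c).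
pose E k := [set w | (k <= holder_lpp gamma A Z (mk k) w)%N].
have h01 : 0 <= (2^-1 : R) < 1 by apply/andP; split; lra.
have mE k : measurable (E k).
  exact: (@measurable_holder_lpp_ge _ _ _ P Z gamma A (ltW A0)).
have PE k : (0 < k)%N -> (P (E k) <= (2^-1 ^+ k)%:E)%E.
  move=> k0; apply: le_trans (holder_lpp_ge_le t0 x0 A0 gamma0 iid _ k0) _.
  have k1 : 0 < k%:R :> R by rewrite ltr0n.
  have kg0 : 0 < k%:R `^ g by rewrite powR_gt0.
  rewrite lee_fin; apply: lerXn2r; rewrite ?nnegrE //.
    by rewrite divr_ge0 ?mulr_ge0 ?powR_ge0 ?expR_ge0 ?(ltW A0) ?(ltW x0).
  have /andP[mk1 _] := truncn_itv (divr_ge0 (ltW kg0) (ltW c0)).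
  rewrite -/(mk k) ler_pdivlMr // in mk1.
  rewrite -/g ler_pdivrMr ?mulr_gt0 //.
  apply: le_trans (_ : 15 * expR 2 * A * t `^ gamma * (mk k)%:R <= _).
    rewrite !ler_wpM2r ?powR_ge0 ?(ltW A0) //.
    by rewrite ler_piMr // mulr_ge0 // ltW.
  have -> : 15 * expR 2 * A * t `^ gamma * (mk k)%:R = 2^-1 * ((mk k)%:R * c) * x.
    by rewrite /c /D; field; rewrite gt_eqF.
  by rewrite [x * _]mulrC [leRHS]mulrA ler_pM2r // ler_pM2l.
have [N [mN N0 sN]] := ae_eventually_not h01 mE PE.
exists N; split=> // w /= nw; apply: sN => /= -[k0 hk0]; apply: nw.
exists (Num.truncn (k0%:R `^ g / c)).+1 => m m0m.
pose u := (c * m%:R) `^ g^-1.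
have -> : 30 * expR 2 * (D * m%:R) = c * m%:R by rewrite /c mulrA.
rewrite -/u; have u0 : 0 <= u by rewrite powR_ge0.
have cm0 : 0 <= c * m%:R by rewrite mulr_ge0 // ltW.
have k0u : k0%:R <= u.
  rewrite leNgt; apply/negP => uk.
  have := @gt0_ltr_powR _ _ g0 u k0%:R; rewrite !nnegrE u0 ler0n => /(_ isT isT uk).
  rewrite powRK // => lt; have : k0%:R `^ g < c * m%:R.
    rewrite mulrC -ltr_pdivrMr //.
    have /andP[_] := truncn_itv (divr_ge0 (powR_ge0 k0%:R g) (ltW c0)).
    by move=> /lt_le_trans; apply; rewrite ler_nat.
  by move=> /(lt_trans lt); rewrite ltxx.
have /andP[tu1 tu2] := truncn_itv u0.
(* The least integer above [u]: a chain shorter than [k] has at most [truncn u <= u] points, so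
   rounding loses nothing. *)
pose k := (Num.truncn u).+1.
have k0k : (k0 <= k)%N by rewrite -(ler_nat R); apply: le_trans k0u _; exact: ltW.
have mmk : (m <= mk k)%N.
  rewrite /mk -[m](@natrK R m).
  apply: le_truncn; rewrite ler_pdivlMr // mulrC -(powRK cm0).
  by rewrite ge0_ler_powR ?nnegrE // ltW.
have := hk0 k k0k; rewrite /E /= => /negP; rewrite -ltnNge ltnS => Lk.
apply: le_trans tu1; rewrite ler_nat; apply: leq_trans Lk.
exact: (@holder_lpp_mono _ _ _ P Z gamma A (ltW A0)).
Qed.

(** The parameters [theta] and [k1] treat [gamma > 0] and [gamma = 0] together. The size [mk k]
    makes [c2 mu m / k >= 2], so that the lower tail bound becomes [e^(- c2 k)]. *)
Lemma ae_holder_lpp_lower (theta : R) (k1 : nat) : 0 < theta -> 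
  (forall k, (k1 <= k)%N ->
     Num.min (A * t `^ gamma / (x * k%:R `^ gamma)) 1 = theta * D / k%:R `^ gamma) ->
  {ae P, forall w, exists m0 : nat, forall m : nat, (m0 <= m)%N ->
  ((128 * 4 `^ gamma)^-1 * theta * (D * m%:R)) `^ g^-1 <= (holder_lpp gamma A Z m w)%:R}.
Proof.
move=> th0 hth.
pose c2 : R := (32 * 4 `^ gamma)^-1.
have f0 : 0 < 4 `^ gamma :> R by rewrite powR_gt0.
have c20 : 0 < c2 by rewrite invr_gt0 mulr_gt0.
pose mu (k : nat) : R := Num.min (A * t `^ gamma / (x * k%:R `^ gamma)) 1.
have mu0 k : (0 < k)%N -> 0 < mu k.
  move=> k0; rewrite lt_min ltr01 andbT divr_gt0 ?mulr_gt0 ?powR_gt0 //.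
  by rewrite ltr0n.
pose mk k := (Num.truncn (2 / c2 * k%:R / mu k)).+1.
pose E k := [set w | (holder_lpp gamma A Z (mk k) w <= k)%N].
pose z : R := expR (- c2).
have z01 : 0 <= z < 1 by rewrite expR_ge0 /z expR_lt1 oppr_lt0.
have mE k : measurable (E k).
  exact: (@measurable_holder_lpp_le _ _ _ P Z gamma A (ltW A0)).
have PE k : (0 < k)%N -> (P (E k) <= (z ^+ k)%:E)%E.
  move=> k0; apply: le_trans (holder_lpp_le_le t0 x0 A0 gamma0 iid _ k0) _.
  have kR : 0 < k%:R :> R by rewrite ltr0n.
  rewrite -/c2 -/(mu k) lee_fin /z -expRM_natl ler_expR.
  have m0 := mu0 _ k0.
  have q0 : 0 <= 2 / c2 * k%:R / mu k by rewrite !mulr_ge0 ?invr_ge0 ?ltW.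
  have /andP[_] := truncn_itv q0; rewrite -/(mk k) => mk2.
  have big : 2 <= c2 * mu k * ((mk k)%:R / k%:R).
    have -> : 2 = c2 * mu k * (2 / c2 * k%:R / mu k / k%:R).
      by field; rewrite !gt_eqF.
    by rewrite ler_pM2l ?mulr_gt0 // ler_pM2r ?invr_gt0 // ltW.
  have -> : k%:R * - c2 = c2 * k%:R * -1 by ring.
  by rewrite ler_pM2l ?mulr_gt0 //; lra.
have [N [mN N0 sN]] := ae_eventually_not z01 mE PE.
exists N; split=> // w /= nw; apply: sN => /= -[k0 hk0]; apply: nw.
pose a : R := c2 / 2 * (theta * D).
have a0 : 0 < a := mulr_gt0 (divr_gt0 c20 (@ltr0Sn R 1)) (mulr_gt0 th0 D0).
pose K := maxn k0 (maxn k1 1).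
exists (Num.truncn (K%:R `^ g / a)).+3 => m m0m.
have m2 : (2 <= m)%N by exact: leq_trans m0m.
have mR : 2 <= m%:R :> R by rewrite (ler_nat R 2).
(* The [m - 1] makes up for the successor in [mk]. It is at least [m / 2], which turns [c2 / 2] into
   [c2 / 4] and so 32 into 128. *)
pose v := (a * (m%:R - 1)) `^ g^-1.
have am0 : 0 <= a * (m%:R - 1) by rewrite mulr_ge0 ?(ltW a0) //; lra.
have v0 : 0 <= v by rewrite powR_ge0.
have Kv : K%:R <= v.
  rewrite leNgt; apply/negP => vK.
  have := @gt0_ltr_powR _ _ g0 v K%:R; rewrite !nnegrE v0 ler0n => /(_ isT isT vK).
  rewrite powRK // => lt; have : K%:R `^ g < a * (m%:R - 1).
    rewrite mulrC -ltr_pdivrMr //.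
    have /andP[_] := truncn_itv (divr_ge0 (powR_ge0 K%:R g) (ltW a0)).
    move=> /lt_le_trans; apply; rewrite lerBrDr natr1 ler_nat.
    exact: leq_trans m0m.
  by move=> /(lt_trans lt); rewrite ltxx.
have /andP[tv1 tv2] := truncn_itv v0.
pose k := Num.truncn v.
have Kk : (K <= k)%N by rewrite -[K](@natrK R K); exact: le_truncn.
have [k0k k1k kp] : [/\ (k0 <= k)%N, (k1 <= k)%N & (0 < k)%N].
  by move: Kk; rewrite /K !geq_max => /and3P[].
have kR : 0 < k%:R :> R by rewrite ltr0n.
have kg : k%:R * k%:R `^ gamma = k%:R `^ g.
  by rewrite /g powRD ?powRr1 ?(ltW kR) // (gt_eqF kR) implybT.
have mkm : (mk k <= m)%N.
  rewrite /mk -(prednK (ltnW m2)) ltnS -[m.-1](@natrK R m.-1); apply: le_truncn.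
  have -> : m.-1%:R = m%:R - 1 :> R by rewrite -{2}(prednK (ltnW m2)) -natr1 addrK.
  rewrite /mu hth //.
  have -> : 2 / c2 * k%:R / (theta * D / k%:R `^ gamma) = k%:R `^ g / a.
    by rewrite -kg /a; field; rewrite !gt_eqF ?powR_gt0.
  rewrite ler_pdivrMr // mulrC -(powRK am0).
  by rewrite ge0_ler_powR ?nnegrE ?(ltW g0).
have := hk0 k k0k; rewrite /E /= => /negP; rewrite -ltnNge => kL.
apply: le_trans (_ : v <= _); last first.
  apply: le_trans (ltW tv2) _; rewrite ler_nat; apply: leq_trans kL _.
  exact: (@holder_lpp_mono _ _ _ P Z gamma A (ltW A0)).
rewrite /v ge0_ler_powR ?invr_ge0 ?(ltW g0) ?nnegrE //.
  have F0 : 0 <= (128 * 4 `^ gamma)^-1 :> R by rewrite invr_ge0 mulr_ge0 // ltW.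
  exact: mulr_ge0 (mulr_ge0 F0 (ltW th0)) (mulr_ge0 (ltW D0) (ler0n _ _)).
have -> : (128 * 4 `^ gamma)^-1 * theta * (D * m%:R) = a * (m%:R / 2).
  by rewrite /a /c2; field; rewrite gt_eqF.
by rewrite ler_pM2l //; lra.
Qed.

End AlmostSureOrder.

(** For [gamma = 0] the lower bound carries the factor [min 1 (x / A)]: a chain has at most [m]
    points, so the ratio is at most [x / A], and no universal [C] bounds it from below for large
    [A]. *)
Theorem theorem2p1 (R : realType) :
  (exists2 c : R, 0 < c &
    forall gamma : R, 0 <= gamma ->
    exists c1 c2 : R,
      [/\ 0 < c1, 0 < c2, c1 <= c * (1 + gamma) `^ (- 2^-1) &
      forall (d : measure_display) (T : measurableType d) (P : probability T R)
             (t x A : R)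
             (Z : nat -> {RV P >-> (measurableTypeR R * measurableTypeR R)%type}),
        0 < t -> 0 < x -> 0 < A ->
        iid_uniform (Lambda t x) Z ->
        forall k m : nat, (1 <= k)%N -> (k <= m)%N ->
          (P [set w | (k <= holder_lpp gamma A Z m w)%N]
             <= ((c1 * A * t `^ gamma * m%:R / (x * k%:R `^ (1 + gamma))) ^+ k)%:E)%E
          /\
          (P [set w | (holder_lpp gamma A Z m w <= k)%N]
             <= (expR (c2 * k%:R *
                  (1 - c2 * Num.min (A * t `^ gamma / (x * k%:R `^ gamma)) 1
                          * (m%:R / k%:R))))%:E)%E])
  /\
  (exists2 C : R, 0 < C &
    forall (t x gamma A : R), 0 < t -> 0 < x -> 0 <= gamma -> 0 < A ->
    forall (d : measure_display) (T : measurableType d) (P : probability T R)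
           (Z : nat -> {RV P >-> (measurableTypeR R * measurableTypeR R)%type}),
      iid_uniform (Lambda t x) Z ->
      {ae P, forall w, exists m0 : nat, forall m : nat, (m0 <= m)%N ->
        let ratio := (holder_lpp gamma A Z m w)%:R
          / ((A * t `^ gamma / x) `^ (1 + gamma)^-1 * m%:R `^ (1 + gamma)^-1) in
        [/\ 0 < gamma -> C^-1 <= ratio,
            gamma = 0 -> C^-1 * Num.min 1 (x / A) <= ratio &
            ratio <= C]}).
Proof.
split.
  exists (15 * expR 2); first by rewrite mulr_gt0 // expR_gt0.
  move=> gamma gamma0.
  exists (15 * expR 2 * (1 + gamma) `^ (- 2^-1)), (32 * 4 `^ gamma)^-1; split=> //.
    by rewrite !mulr_gt0 ?expR_gt0 ?powR_gt0 // ltr_pwDl.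
  move=> d T P t x A Z t0 x0 A0 iid k m k0 km; split.
    exact: holder_lpp_ge_le.
  exact: holder_lpp_le_le.
(* From [128 <= K] and [4 <= K] follows [128 * 4 ^ gamma <= K^(1 + gamma)], so the root of exponent
   [1 / (1 + gamma)] leaves the constant [K], free of [gamma]. *)
have [K [K0 K1 K2]] : exists K : R, [/\ 0 < K, 4 <= K & 128 <= K].
  by exists 128; split; rewrite ?ltr0n ?ler_nat.
exists (30 * expR 2 + K).
  exact: addr_gt0 (mulr_gt0 (@ltr0Sn R 29) (expR_gt0 2)) K0.
move=> t x gamma A t0 x0 gamma0 A0 d T P Z iid.
set C := 30 * expR 2 + K.
have e1 : 1 <= expR 2 :> R by apply: le_trans (expR_ge1Dx _); lra.
have g0 : 0 < 1 + gamma by rewrite ltr_pwDl.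
have g1 : (1 + gamma)^-1 <= 1 by rewrite invf_le1 // lerDl.
pose D := A * t `^ gamma / x.
have D0 : 0 < D by rewrite divr_gt0 // mulr_gt0 // powR_gt0.
(* For [gamma = 0] the minimum in the lower tail bound is the constant [min (A / x) 1], which is [D]
   times [min 1 (x / A)]. *)
pose theta : R := if gamma == 0 then Num.min 1 (x / A) else 1.
have th0 : 0 < theta.
  by rewrite /theta; case: ifP => _ //; rewrite lt_min ltr01 divr_gt0.
have [k1 hk1] : exists k1 : nat, forall k, (k1 <= k)%N ->
    Num.min (A * t `^ gamma / (x * k%:R `^ gamma)) 1 = theta * D / k%:R `^ gamma.
  rewrite /theta; case: eqP => [gE|gN].
    exists 0%N => k _; rewrite /D gE !powRr0 !mulr1 ?divr1.
    rewrite minr_pMl ?divr_ge0 ?(ltW A0) ?(ltW x0) // mul1r; congr Num.min.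
    by field; rewrite !gt_eqF.
  have gp : 0 < gamma by rewrite lt_neqAle gamma0 andbT eq_sym; apply/eqP.
  (* From this index on [k^gamma >= D], so the minimum is its first term. *)
  exists (Num.truncn (D `^ gamma^-1)).+1 => k kk.
  have kR : 0 < k%:R :> R by rewrite ltr0n (leq_trans _ kk).
  rewrite mul1r; have -> : A * t `^ gamma / (x * k%:R `^ gamma) = D / k%:R `^ gamma.
    by rewrite /D; field; rewrite !gt_eqF // powR_gt0.
  apply/min_idPl; rewrite ler_pdivrMr ?powR_gt0 // mul1r.
  have {1}-> : D = (D `^ gamma^-1) `^ gamma.
    by rewrite -powRrM mulVf ?gt_eqF // powRr1 // ltW.
  rewrite ge0_ler_powR ?nnegrE ?powR_ge0 //.
  have /andP[_ /ltW] := truncn_itv (powR_ge0 D gamma^-1).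
  by move=> /le_trans; apply; rewrite ler_nat.
have up := ae_holder_lpp_upper t0 x0 A0 gamma0 iid.
have low := ae_holder_lpp_lower t0 x0 A0 gamma0 iid th0 hk1.
have : {ae P, forall w, (exists m0 : nat, forall m : nat, (m0 <= m)%N ->
     (holder_lpp gamma A Z m w)%:R <= (30 * expR 2 * (D * m%:R)) `^ (1 + gamma)^-1)
  /\ (exists m0 : nat, forall m : nat, (m0 <= m)%N ->
     ((128 * 4 `^ gamma)^-1 * theta * (D * m%:R)) `^ (1 + gamma)^-1
       <= (holder_lpp gamma A Z m w)%:R)}.
  by apply: filterI.
apply: filterS => w [[m1 hm1] [m2 hm2]].
exists (maxn 1 (maxn m1 m2)) => m mm.
set ratio := (holder_lpp gamma A Z m w)%:R / _.
have /and3P[m0 m1m m2m] : [&& 1 <= m, m1 <= m & m2 <= m]%N by rewrite -!geq_max.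
have mR : 0 < m%:R :> R by rewrite ltr0n.
pose e := (1 + gamma)^-1.
pose den := D `^ e * m%:R `^ e.
have den0 : 0 < den by rewrite mulr_gt0 ?powR_gt0.
have Dm : (D * m%:R) `^ e = den by rewrite powRM // ltW.
have ratioE : ratio = (holder_lpp gamma A Z m w)%:R / den by [].
have lo : K^-1 * theta `^ e <= ratio.
  rewrite ratioE ler_pdivlMr //; apply: le_trans (hm2 m m2m).
  have f0 : 0 <= (128 * 4 `^ gamma)^-1 :> R by rewrite invr_ge0 mulr_ge0 ?powR_ge0.
  rewrite powRM ?(mulr_ge0 f0 (ltW th0)) ?(mulr_ge0 (ltW D0) (ltW mR)) // -/e Dm ler_pM2r //.
  rewrite powRM ?(ltW th0) // ler_pM2r ?powR_gt0 //.
  have {1}-> : K^-1 = (K^-1 `^ (1 + gamma)) `^ e :> R.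
    by rewrite -powRrM mulfV ?(gt_eqF g0) // powRr1 // invr_ge0 ltW.
  rewrite ge0_ler_powR ?nnegrE ?powR_ge0 ?invr_ge0 ?(ltW g0) //.
  rewrite -[K^-1]powR_inv1 ?(ltW K0) // -powRrM mulN1r powRN lef_pV2 ?posrE ?mulr_gt0 ?powR_gt0 //.
  rewrite powRD; last by rewrite (gt_eqF K0) implybT.
  rewrite powRr1 ?(ltW K0) //; apply: ler_pM; rewrite ?powR_ge0 ?ler0n //.
  by rewrite ge0_ler_powR ?nnegrE ?ler0n ?(ltW K0).
have CK : C^-1 <= K^-1.
  by rewrite lef_pV2 ?posrE //; rewrite /C; lra.
split.
- move=> gp; apply: le_trans CK _; apply: le_trans lo.
  by rewrite /theta gt_eqF // powR1 mulr1.
- move=> gE; apply: le_trans lo; rewrite /theta gE eqxx /e gE addr0 invr1 powRr1.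
    by rewrite ler_wpM2r // le_min ler01 divr_ge0 // ltW.
  by rewrite le_min ler01 divr_ge0 // ltW.
rewrite ratioE ler_pdivrMr //; apply: le_trans (hm1 m m1m) _.
rewrite powRM ?(mulr_ge0 (ltW D0) (ltW mR)) ?mulr_ge0 ?expR_ge0 // -/e Dm ler_pM2r //.
(* The base is at least 1 and the exponent at most 1, so the root does not exceed the base. *)
apply: le_trans (_ : 30 * expR 2 <= _); last by rewrite /C; lra.
by rewrite ler1_powR //; lra.
Qed.
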